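(* Let $a,z\in\mathbb{C}$ be such that none of $a$, $a+z$, $a-z$ belongs to $\{0,-1,-2,\dots\}$. Then $$\Gamma(a+z)\Gamma(a-z)=\Gamma(a)^2+\sum_{k=0}^{\infty}\frac{(-1)^{k+1}\,\Gamma(2a+k)}{(a+k)\,k!}\cdot\frac{2z^2}{z^2-(a+k)^2}.$$
   Context: $\Gamma$ denotes Euler's gamma function.
   Formalization: Two conditions are added: 2a is not in {0,-1,-2,...} (otherwise some Γ(2a+k) is at a pole, e.g. a=-1/2), and Re a < 2 or z = 0 (otherwise the terms do not tend to 0 and the series diverges, e.g. a=2, z=1/2). *)

(* Defs.v *)
From Stdlib Require Import Reals Factorial.
From Coquelicot Require Import Coquelicot.

(* [x ^ s = exp (s * ln x)] for real [x > 0] and complex [s]. *)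
Definition RCpow (x : R) (s : C) : C :=
  (exp (Re s * ln x) * cos (Im s * ln x),
   exp (Re s * ln x) * sin (Im s * ln x))%R.

(* Rising factorial [s (s + 1) ... (s + n - 1)]. *)
Fixpoint Crising (s : C) (n : nat) : C :=
  match n with
  | O => RtoC 1
  | S m => (Crising s m * (s + RtoC (INR m)))%C
  end.

(* Euler's limit formula
     Gamma s = lim_n  n! n^s / (s (s + 1) ... (s + n)),
   which converges for every [s] outside {0, -1, -2, ...}; the limit is taken
   componentwise.  The values at the poles are meaningless. *)
Definition Gamma_seq (s : C) (n : nat) : C :=
  (RtoC (INR (fact n)) * RCpow (INR n) s / Crising s (S n))%C.

Definition CGamma (s : C) : C :=
  (real (Lim_seq (fun n => Re (Gamma_seq s n))),
   real (Lim_seq (fun n => Im (Gamma_seq s n)))).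

Definition nonpos_integer (s : C) : Prop :=
  exists n : nat, s = RtoC (- INR n).

(* Main.v *)
(** Truncating Euler's product at [n], the product of the two Gamma factors
    becomes [n!^2 n^(2a) / prod_(k <= n) ((a + k)^2 - z^2)], a rational function
    of [z^2] with simple poles.  Its partial fraction expansion minus the same
    expansion at [z = 0] is exactly the series of the theorem, cut at [k = n],
    with [Gamma (2a + k) / k!] replaced by an approximation [residue_seq].  To
    let [n] tend to infinity when the series is only conditionally convergent
    ([3/2 <= Re a < 2]), one sums by parts against [(-1)^k]: the differences of
    consecutive terms are [O (k ^ (2 Re a - 5))] uniformly in [n], so dominated
    convergence applies to them. *)

Require Import Defs.
From Stdlib Require Import Reals Factorial Lra Lia.
From Coquelicot Require Import Coquelicot.

Local Open Scope R_scope.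

(** * Limits of complex sequences *)

(** Term [k] of the series has size about [k ^ (2 Re a - 4)] when [z] is not 0, so [Re a < 2] is the
    range in which the terms tend to 0. Without the subtraction at [z = 0] they would only be of
    order [k ^ (2 Re a - 2)].

    The obstacle is uniformity in [n]. Truncation multiplies the limit of [residue_seq s n k] by
    roughly [exp (- k ^ 2 / n)], so its relative increment in [k] is of order [(1 + k ^ 2 / n) / k]
    and not [1 / k]. The extra factor is harmless only because the residues are themselves small
    where it is large; their bound must therefore carry the weight [1 + k ^ 2 / n].

    That [2 a] is not a nonpositive integer serves twice: [(a + j) ^ 2 - (a + k) ^ 2 = (j - k) (2 a
    + j + k)] vanishes for no two distinct indices, so the poles are simple, and no
    [Gamma (2 a + k)] is taken at a pole.

    Majorants are written as telescoping differences, so bounds on products and tails of sums need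
    neither integrals nor real powers. *)

Definition is_Clim (u : nat -> C) (l : C) : Prop :=
  is_lim_seq (fun n => Cmod (u n - l)) 0.

Lemma is_lim_seq_le_0 (u v : nat -> R) :
  eventually (fun n => 0 <= u n <= v n) -> is_lim_seq v 0 -> is_lim_seq u 0.
Proof.
  intros H Hv.
  apply (is_lim_seq_le_le_loc (fun _ => 0) u v); auto.
  apply is_lim_seq_const.
Qed.

Lemma Cmod_le_abs (z : C) : Cmod z <= Rabs (Re z) + Rabs (Im z).
Proof.
  replace z with (RtoC (Re z) + (0, Im z))%C at 1
    by (destruct z; apply injective_projections; simpl; ring).
  eapply Rle_trans; [apply Cmod_triangle|].
  rewrite Cmod_R. apply Rplus_le_compat_l.
  replace (0, Im z) with (Ci * RtoC (Im z))%C
    by (apply injective_projections; simpl; ring).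
  rewrite Cmod_mult, Cmod_Ci, Cmod_R. lra.
Qed.

Lemma im_le_Cmod (z : C) : Rabs (Im z) <= Cmod z.
Proof. eapply Rle_trans; [apply Rmax_r|apply Rmax_Cmod]. Qed.

Lemma Cmod_triangle_inv (x y : C) : Cmod x - Cmod y <= Cmod (x + y).
Proof.
  assert (H := Cmod_triangle (x + y) (- y)). rewrite Cmod_opp in H.
  replace (x + y + - y)%C with x in H by ring. lra.
Qed.

Lemma is_Clim_const (c : C) : is_Clim (fun _ => c) c.
Proof.
  unfold is_Clim. apply is_lim_seq_ext with (fun _ => 0).
  - intros n. replace (c - c)%C with (RtoC 0) by ring. now rewrite Cmod_0.
  - apply is_lim_seq_const.
Qed.

Lemma is_Clim_ext_loc (u v : nat -> C) (l : C) :
  eventually (fun n => u n = v n) -> is_Clim u l -> is_Clim v l.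
Proof.
  intros [N H] Hu. apply (is_lim_seq_ext_loc (fun n => Cmod (u n - l))); auto.
  exists N. intros n Hn. now rewrite H.
Qed.

Lemma is_Clim_plus (u v : nat -> C) (l m : C) :
  is_Clim u l -> is_Clim v m -> is_Clim (fun n => u n + v n)%C (l + m)%C.
Proof.
  intros Hu Hv. eapply is_lim_seq_le_0.
  - exists 0%nat. intros n _. split; [apply Cmod_ge_0|].
    replace (u n + v n - (l + m))%C with ((u n - l) + (v n - m))%C by ring.
    apply Cmod_triangle.
  - replace 0 with (0 + 0) by ring. now apply is_lim_seq_plus'.
Qed.

Lemma is_Clim_mult (u v : nat -> C) (l m : C) :
  is_Clim u l -> is_Clim v m -> is_Clim (fun n => u n * v n)%C (l * m)%C.
Proof.
  intros Hu Hv. eapply is_lim_seq_le_0.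
  - exists 0%nat. intros n _. split; [apply Cmod_ge_0|].
    replace (u n * v n - l * m)%C
      with ((u n - l) * (v n - m) + ((u n - l) * m + l * (v n - m)))%C by ring.
    eapply Rle_trans; [apply Cmod_triangle|].
    apply Rplus_le_compat; [|eapply Rle_trans; [apply Cmod_triangle|]];
      rewrite !Cmod_mult; apply Rle_refl.
  - replace 0 with (0 * 0 + (0 * Cmod m + Cmod l * 0)) by ring.
    apply is_lim_seq_plus'; [now apply is_lim_seq_mult'|].
    apply is_lim_seq_plus'; apply is_lim_seq_mult'; auto;
      apply is_lim_seq_const.
Qed.

Lemma is_Clim_scal (c : C) (u : nat -> C) (l : C) :
  is_Clim u l -> is_Clim (fun n => c * u n)%C (c * l)%C.
Proof. intros Hu. apply is_Clim_mult; auto. apply is_Clim_const. Qed.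

Lemma is_Clim_minus (u v : nat -> C) (l m : C) :
  is_Clim u l -> is_Clim v m -> is_Clim (fun n => u n - v n)%C (l - m)%C.
Proof.
  intros Hu Hv.
  apply (is_Clim_ext_loc (fun n => u n + (-(1)) * v n)%C).
  - exists 0%nat. intros n _. ring.
  - replace (l - m)%C with (l + (-(1)) * m)%C by ring.
    apply is_Clim_plus; auto. now apply is_Clim_scal.
Qed.

Lemma is_Clim_Cmod (u : nat -> C) (l : C) :
  is_Clim u l -> is_lim_seq (fun n => Cmod (u n)) (Cmod l).
Proof.
  intros H.
  apply is_lim_seq_ext with (fun n => (Cmod (u n) - Cmod l) + Cmod l);
    [intros; ring|].
  replace (Finite (Cmod l)) with (Finite (0 + Cmod l)) by (f_equal; ring).
  apply is_lim_seq_plus'; [|apply is_lim_seq_const].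
  apply is_lim_seq_abs_0. eapply is_lim_seq_le_0; [|exact H].
  exists 0%nat. intros n _. split; [apply Rabs_pos|].
  apply Rabs_le.
  assert (H1 := Cmod_triangle_inv (u n) (l - u n)).
  assert (H2 := Cmod_triangle_inv l (u n - l)).
  assert (H3 := Cmod_triangle (u n - l) l).
  replace (l + (u n - l))%C with (u n) in H2 by ring.
  replace (u n - l + l)%C with (u n) in H3 by ring. lra.
Qed.

Lemma is_Clim_Re (u : nat -> C) (l : C) :
  is_Clim u l -> is_lim_seq (fun n => Re (u n)) (Re l).
Proof.
  intros H.
  apply is_lim_seq_ext with (fun n => Re (u n - l) + Re l);
    [intros; unfold Re; simpl; ring|].
  replace (Finite (Re l)) with (Finite (0 + Re l)) by (f_equal; ring).
  apply is_lim_seq_plus'; [|apply is_lim_seq_const].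
  apply is_lim_seq_abs_0. eapply is_lim_seq_le_0; [|exact H].
  exists 0%nat. intros n _. split; [apply Rabs_pos|apply re_le_Cmod].
Qed.

Lemma is_Clim_Im (u : nat -> C) (l : C) :
  is_Clim u l -> is_lim_seq (fun n => Im (u n)) (Im l).
Proof.
  intros H.
  apply is_lim_seq_ext with (fun n => Im (u n - l) + Im l);
    [intros; unfold Im; simpl; ring|].
  replace (Finite (Im l)) with (Finite (0 + Im l)) by (f_equal; ring).
  apply is_lim_seq_plus'; [|apply is_lim_seq_const].
  apply is_lim_seq_abs_0. eapply is_lim_seq_le_0; [|exact H].
  exists 0%nat. intros n _. split; [apply Rabs_pos|apply im_le_Cmod].
Qed.

Lemma is_Clim_pair (u : nat -> C) (x y : R) :
  is_lim_seq (fun n => Re (u n)) x -> is_lim_seq (fun n => Im (u n)) y ->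
  is_Clim u (x, y).
Proof.
  intros Hx Hy. eapply is_lim_seq_le_0.
  - exists 0%nat. intros n _. split; [apply Cmod_ge_0|apply Cmod_le_abs].
  - replace 0 with (Rabs (x - x) + Rabs (y - y))
      by (rewrite !Rminus_diag, Rabs_R0; ring).
    apply is_lim_seq_plus';
      apply (is_lim_seq_abs _ (Finite _)); simpl; apply is_lim_seq_minus'; auto;
      apply is_lim_seq_const.
Qed.

Lemma is_Clim_unique (u : nat -> C) (l m : C) :
  is_Clim u l -> is_Clim u m -> l = m.
Proof.
  intros Hl Hm. apply injective_projections.
  - generalize (is_lim_seq_unique _ _ (is_Clim_Re _ _ Hl)).
    rewrite (is_lim_seq_unique _ _ (is_Clim_Re _ _ Hm)). now injection 1.
  - generalize (is_lim_seq_unique _ _ (is_Clim_Im _ _ Hl)).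
    rewrite (is_lim_seq_unique _ _ (is_Clim_Im _ _ Hm)). now injection 1.
Qed.

Lemma is_Clim_is_series (f : nat -> C) (l : C) :
  is_Clim (sum_n (G := C_AbelianMonoid) f) l ->
  is_series (K := C_AbsRing) (V := C_NormedModule) f l.
Proof.
  intros H. unfold is_series.
  apply filterlim_locally. intros eps.
  apply is_lim_seq_spec in H. destruct (H eps) as [N HN].
  exists N. intros n Hn. apply C_NormedModule_mixin_compat1.
  specialize (HN n Hn). rewrite Rminus_0_r, Rabs_pos_eq in HN;
    [exact HN|apply Cmod_ge_0].
Qed.

(** * Products whose factors are close to 1 *)

Lemma exp_le_exp (x y : R) : x <= y -> exp x <= exp y.
Proof. intros [h|h]; [left; now apply exp_increasing|subst; lra]. Qed.

(** A discrete Gronwall bound, by [1 + t <= exp t]. The rates enter as increments of [D], so the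
    exponents telescope and no sum of rates has to be estimated. *)
Lemma product_bound (x D : nat -> R) (m : nat) :
  (forall k, 0 <= x k) ->
  (forall k, (k < m)%nat -> x (S k) <= x k * (1 + (D (S k) - D k))) ->
  forall k, (k <= m)%nat -> x k <= x O * exp (D k - D O).
Proof.
  intros Hx H k. induction k as [|k IH]; intros Hk.
  - rewrite Rminus_diag, exp_0. lra.
  - eapply Rle_trans; [apply H; lia|].
    replace (D (S k) - D O) with ((D k - D O) + (D (S k) - D k)) by ring.
    rewrite exp_plus, <- Rmult_assoc.
    apply Rle_trans with (x k * exp (D (S k) - D k)).
    + apply Rmult_le_compat_l; auto. apply exp_ineq1_le.
    + apply Rmult_le_compat_r; [left; apply exp_pos|]. apply IH. lia.
Qed.

(** The right side is the left side times [2 * t / (t + 1)], which is at least 1. This is how sums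
    of inverse squares are made to telescope. *)
Lemma inv_square_telescope (B t : R) : 0 <= B -> 1 <= t ->
  B / t ^ 2 <= 2 * B / t - 2 * B / (t + 1).
Proof.
  intros HB Ht.
  replace (2 * B / t - 2 * B / (t + 1)) with (B / t ^ 2 * (2 * t / (t + 1)))
    by (field; lra).
  rewrite <- (Rmult_1_r (B / t ^ 2)) at 1.
  apply Rmult_le_compat_l.
  - apply Rmult_le_pos; auto. left. apply Rinv_0_lt_compat. nra.
  - apply Rmult_le_reg_r with (t + 1); [lra|].
    replace (2 * t / (t + 1) * (t + 1)) with (2 * t) by (field; lra). lra.
Qed.

Lemma is_lim_seq_inv_S (c : R) : is_lim_seq (fun n => c / (INR n + 1)) 0.
Proof.
  replace 0 with (c * 0) by ring.
  apply (is_lim_seq_scal_l _ c 0).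
  apply (is_lim_seq_inv _ p_infty); [|discriminate].
  apply is_lim_seq_ext with (fun n => INR (S n)); [apply S_INR|].
  rewrite <- is_lim_seq_incr_1. apply is_lim_seq_INR.
Qed.

(** Such a [g] behaves like an infinite product with factors [1 + O(1 / n ^ 2)]: the product bound
    makes it bounded, and boundedness makes its increments summable. *)
Lemma is_Clim_of_ratio (g : nat -> C) (B : R) :
  0 <= B ->
  (forall n, Cmod (g (S n) - g n) <= Cmod (g n) * (B / (INR n + 1) ^ 2)) ->
  exists l, is_Clim g l.
Proof.
  intros HB H.
  assert (Hb : forall n, Cmod (g n) <= Cmod (g O) * exp (2 * B)).
  { intros n.
    assert (Hp := product_bound (fun n => Cmod (g n))
      (fun n => - (2 * B / (INR n + 1))) n (fun n => Cmod_ge_0 _)).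
    eapply Rle_trans; [apply (Hp) with (k := n); auto|].
    - intros k _. rewrite S_INR.
      assert (Ht := inv_square_telescope B (INR k + 1) HB).
      assert (Hk := pos_INR k).
      replace (g (S k)) with (g k + (g (S k) - g k))%C by ring.
      eapply Rle_trans; [apply Cmod_triangle|].
      rewrite Rmult_plus_distr_l, Rmult_1_r. apply Rplus_le_compat_l.
      eapply Rle_trans; [apply H|].
      apply Rmult_le_compat_l; [apply Cmod_ge_0|]. lra.
    - apply Rmult_le_compat_l; [apply Cmod_ge_0|].
      apply exp_le_exp. simpl (INR 0).
      assert (0 <= 2 * B / (INR n + 1)).
      { assert (Hk := pos_INR n). apply Rmult_le_pos; [lra|].
        left. apply Rinv_0_lt_compat. lra. }
      lra. }
  set (M := Cmod (g O) * exp (2 * B)) in *.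
  assert (HM : 0 <= M) by (eapply Rle_trans; [apply Cmod_ge_0|apply (Hb O)]).
  assert (Hd : forall n p, Cmod (g (n + p)%nat - g n)
            <= 2 * (M * B) / (INR n + 1) - 2 * (M * B) / (INR (n + p) + 1)).
  { intros n p. induction p as [|p IH].
    - rewrite Nat.add_0_r. replace (g n - g n)%C with (RtoC 0) by ring.
      rewrite Cmod_0. lra.
    - replace (g (n + S p)%nat - g n)%C
        with ((g (S (n + p)) - g (n + p)%nat) + (g (n + p)%nat - g n))%C
        by (rewrite Nat.add_succ_r; ring).
      eapply Rle_trans; [apply Cmod_triangle|].
      rewrite Nat.add_succ_r, S_INR.
      assert (Hk := pos_INR (n + p)).
      assert (Ht := inv_square_telescope (M * B) (INR (n + p) + 1)
        (Rmult_le_pos _ _ HM HB)).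
      assert (Hs : Cmod (g (S (n + p)) - g (n + p)%nat)
                <= M * B / (INR (n + p) + 1) ^ 2).
      { eapply Rle_trans; [apply H|]. unfold Rdiv. rewrite Rmult_assoc.
        apply Rmult_le_compat_r; [|apply Hb].
        apply Rmult_le_pos; auto. left. apply Rinv_0_lt_compat. nra. }
      lra. }
  (* Completeness is that of the reals, applied to [Re] and [Im], of which only the 1-Lipschitz
     property for [Cmod] is used. *)
  assert (Hc : forall f : C -> R,
    (forall x y, Rabs (f x - f y) <= Cmod (x - y)) ->
    ex_finite_lim_seq (fun n => f (g n))).
  { intros f Hf. apply ex_lim_seq_cauchy_corr. intros eps.
    assert (L := is_lim_seq_inv_S (2 * (M * B))).
    apply is_lim_seq_spec in L.
    destruct (L (pos_div_2 eps)) as [N HN]. exists N.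
    assert (HN' : forall n, (N <= n)%nat -> Rabs (f (g n) - f (g N)) < eps / 2).
    { intros n Hn. eapply Rle_lt_trans; [apply Hf|].
      replace n with (N + (n - N))%nat by lia.
      eapply Rle_lt_trans; [apply Hd|].
      specialize (HN N (Nat.le_refl _)). simpl in HN.
      apply Rabs_def2 in HN.
      assert (0 <= 2 * (M * B) / (INR (N + (n - N)) + 1)).
      { assert (Hk := pos_INR (N + (n - N))).
        apply Rmult_le_pos; [nra|]. left. apply Rinv_0_lt_compat. lra. }
      lra. }
    intros n m Hn Hm.
    replace (f (g n) - f (g m))
      with ((f (g n) - f (g N)) - (f (g m) - f (g N))) by ring.
    apply HN' in Hn. apply HN' in Hm.
    apply Rabs_def2 in Hn. apply Rabs_def2 in Hm. apply Rabs_def1; lra. }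
  destruct (Hc Re) as [x Hx].
  { intros u v. apply (re_le_Cmod (u - v)). }
  destruct (Hc Im) as [y Hy].
  { intros u v. apply (im_le_Cmod (u - v)). }
  exists (x, y). now apply is_Clim_pair.
Qed.

(** * Convergence of Euler's limit *)

(** It all comes from [1 + x <= exp x] at [p] and at [- p]; the latter gives [exp p * (1 - p) <= 1],
    an upper bound on [exp p - 1]. *)
Lemma exp_taylor1 (p : R) : Rabs (exp p - 1 - p) <= p ^ 2 * exp (Rabs p).
Proof.
  assert (H1 := exp_ineq1_le p). assert (H2 := exp_ineq1_le (- p)).
  rewrite exp_Ropp in H2. assert (H0 := exp_pos p).
  assert (H3 : exp p * (1 - p) <= 1).
  { apply Rle_trans with (exp p * / exp p); [|right; field; lra].
    apply Rmult_le_compat_l; lra. }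
  rewrite Rabs_pos_eq by lra.
  unfold Rabs. destruct (Rcase_abs p) as [h|h].
  - assert (1 <= exp (- p)) by (rewrite <- exp_0; apply exp_le_exp; lra). nra.
  - nra.
Qed.

Lemma exp_taylor0 (p : R) : Rabs (exp p - 1) <= Rabs p * exp (Rabs p).
Proof.
  assert (H1 := exp_ineq1_le p). assert (H2 := exp_ineq1_le (- p)).
  rewrite exp_Ropp in H2. assert (H0 := exp_pos p).
  assert (H3 : exp p * (1 - p) <= 1).
  { apply Rle_trans with (exp p * / exp p); [|right; field; lra].
    apply Rmult_le_compat_l; lra. }
  unfold Rabs at 2 3. destruct (Rcase_abs p) as [h|h].
  - assert (1 <= exp (- p)) by (rewrite <- exp_0; apply exp_le_exp; lra).
    apply Rabs_le. nra.
  - apply Rabs_le. nra.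
Qed.

Lemma sin_abs_le (x : R) : Rabs (sin x) <= Rabs x.
Proof.
  assert (H : forall y, 0 <= y -> Rabs (sin y) <= y).
  { intros y Hy. apply Rabs_le. split.
    - destruct (Rle_dec y 1).
      + assert (0 <= sin y) by (apply sin_ge_0; generalize PI2_1; lra). lra.
      + generalize (SIN_bound y); lra.
    - destruct Hy as [h|<-]; [left; now apply sin_lt_x|rewrite sin_0; lra]. }
  unfold Rabs at 2. destruct (Rcase_abs x).
  - rewrite <- Rabs_Ropp, <- sin_neg. apply H. lra.
  - apply H. lra.
Qed.

Lemma cos_taylor0 (q : R) : Rabs (cos q - 1) <= Rabs q.
Proof.
  replace q with (2 * (q / 2)) at 1 by field. rewrite cos_2a_sin.
  assert (H := sin_abs_le (q / 2)). assert (Hb := SIN_bound (q / 2)).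
  assert (H1 : Rabs (sin (q / 2)) <= 1) by (apply Rabs_le; lra).
  replace (1 - 2 * sin (q / 2) * sin (q / 2) - 1)
    with (- (2 * (sin (q / 2) * sin (q / 2)))) by ring.
  rewrite Rabs_Ropp, !Rabs_mult, (Rabs_pos_eq 2) by lra.
  rewrite Rabs_div, (Rabs_pos_eq 2) in H by lra.
  assert (0 <= Rabs (sin (q / 2))) by apply Rabs_pos. nra.
Qed.

Lemma cos_taylor1 (q : R) : Rabs (cos q - 1) <= q ^ 2.
Proof.
  replace q with (2 * (q / 2)) at 1 by field. rewrite cos_2a_sin.
  assert (H := sin_abs_le (q / 2)).
  replace (1 - 2 * sin (q / 2) * sin (q / 2) - 1)
    with (- (2 * (sin (q / 2) * sin (q / 2)))) by ring.
  rewrite Rabs_Ropp, !Rabs_mult, (Rabs_pos_eq 2) by lra.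
  rewrite Rabs_div, (Rabs_pos_eq 2) in H by lra.
  assert (0 <= Rabs (sin (q / 2))) by apply Rabs_pos.
  rewrite <- (pow2_abs q). assert (0 <= Rabs q) by apply Rabs_pos. nra.
Qed.

Lemma sin_taylor1 (q : R) : Rabs (sin q - q) <= q ^ 2.
Proof.
  destruct (MVT_gen (fun x => sin x - x) 0 q (fun x => cos x - 1))
    as [c [Hc H]].
  - intros x _. auto_derive; auto. ring.
  - intros x _. apply derivable_continuous_pt.
    exists (cos x - 1). apply is_derive_Reals. auto_derive; auto. ring.
  - rewrite sin_0 in H. replace (sin q - q) with ((cos c - 1) * q) by lra.
    rewrite Rabs_mult, <- (pow2_abs q).
    assert (Hq : Rabs (cos c - 1) <= Rabs q).
    { eapply Rle_trans; [apply cos_taylor0|].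
      revert Hc. unfold Rmin, Rmax, Rabs.
      destruct (Rle_dec 0 q), (Rcase_abs c), (Rcase_abs q); lra. }
    assert (0 <= Rabs q) by apply Rabs_pos. nra.
Qed.

Lemma ln_taylor1 (x : R) : 0 <= x -> x - x ^ 2 <= ln (1 + x) <= x.
Proof.
  intros Hx. split.
  - assert (H := exp_ineq1_le (- ln (1 + x))).
    rewrite exp_Ropp, exp_ln in H by lra.
    assert (/ (1 + x) <= 1 - x + x ^ 2); [|lra].
    apply Rmult_le_reg_l with (1 + x); [lra|].
    rewrite Rinv_r by lra. nra.
  - assert (H := exp_ineq1_le (ln (1 + x))). rewrite exp_ln in H by lra. lra.
Qed.

(** Applied with [x = 1 / n] to the ratio of consecutive terms of Euler's sequence; the quadratic
    error is what makes the product of these ratios converge. *)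
Lemma RCpow_taylor1 (s : C) :
  exists K, 0 <= K /\ forall x, 0 <= x <= 1 ->
    Cmod (RCpow (1 + x) s - (1 + s * RtoC x)) <= K * x ^ 2.
Proof.
  destruct s as [u v].
  set (U := Rabs u). set (V := Rabs v). set (Q := exp U).
  assert (HU : 0 <= U) by apply Rabs_pos.
  assert (HV : 0 <= V) by apply Rabs_pos.
  assert (HQ : 0 < Q) by apply exp_pos.
  (* The first group serves the real part, the second the imaginary part. Each summand bounds one
     term in the three-term splittings of the errors of [exp p * cos q] and [exp p * sin q]
     below. *)
  exists ((U ^ 2 * Q + Q * V ^ 2 + U) + (Q * V ^ 2 + U * Q * V + V)).
  split.
  { assert (0 <= U ^ 2) by nra. assert (0 <= V ^ 2) by nra.
    assert (0 <= Q * V ^ 2) by nra. assert (0 <= U ^ 2 * Q) by nra.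
    assert (0 <= U * Q) by nra. assert (0 <= U * Q * V) by nra. lra. }
  intros x Hx. destruct (ln_taylor1 x) as [L1 L2]; [lra|].
  set (L := ln (1 + x)) in *.
  assert (HL : 0 <= L) by nra.
  assert (HLx : Rabs (L - x) <= x ^ 2) by (apply Rabs_le; lra).
  set (p := u * L). set (q := v * L).
  assert (Hp : Rabs p <= U * x).
  { unfold p. rewrite Rabs_mult, (Rabs_pos_eq L) by auto.
    apply Rmult_le_compat_l; auto. }
  assert (Hq : Rabs q <= V * x).
  { unfold q. rewrite Rabs_mult, (Rabs_pos_eq L) by auto.
    apply Rmult_le_compat_l; auto. }
  assert (He : exp (Rabs p) <= Q) by (apply exp_le_exp; nra).
  assert (He' : Rabs (exp p) <= Q).
  { rewrite Rabs_pos_eq by (left; apply exp_pos).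
    eapply Rle_trans; [|exact He]. apply exp_le_exp, Rle_abs. }
  assert (Hp2 : p ^ 2 <= U ^ 2 * x ^ 2).
  { rewrite <- pow2_abs, <- Rpow_mult_distr. apply pow_incr.
    split; [apply Rabs_pos|auto]. }
  assert (Hq2 : q ^ 2 <= V ^ 2 * x ^ 2).
  { rewrite <- pow2_abs, <- Rpow_mult_distr. apply pow_incr.
    split; [apply Rabs_pos|auto]. }
  assert (P0 := exp_taylor0 p). assert (P1 := exp_taylor1 p).
  assert (C1 := cos_taylor1 q). assert (S1 := sin_taylor1 q).
  eapply Rle_trans; [apply Cmod_le_abs|].
  rewrite Rmult_plus_distr_r. apply Rplus_le_compat.
  - unfold RCpow, Re, Im; simpl fst; simpl snd. fold L p q.
    replace (exp p * cos q + - (1 + (u * x - v * 0)))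
      with ((exp p - 1 - p) + exp p * (cos q - 1) + u * (L - x))
      by (unfold p; ring).
    eapply Rle_trans; [apply Rabs_triang|].
    rewrite !Rmult_plus_distr_r. apply Rplus_le_compat.
    + eapply Rle_trans; [apply Rabs_triang|]. apply Rplus_le_compat.
      * eapply Rle_trans; [apply P1|].
        replace (U ^ 2 * Q * x ^ 2) with (U ^ 2 * x ^ 2 * Q) by ring.
        apply Rmult_le_compat; auto; [nra|left; apply exp_pos].
      * rewrite Rabs_mult, Rmult_assoc.
        apply Rmult_le_compat; try apply Rabs_pos; lra.
    + rewrite Rabs_mult. apply Rmult_le_compat_l; auto.
  - unfold RCpow, Re, Im; simpl fst; simpl snd. fold L p q.
    replace (exp p * sin q + - (0 + (u * 0 + v * x)))
      with (exp p * (sin q - q) + (exp p - 1) * q + v * (L - x))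
      by (unfold q; ring).
    eapply Rle_trans; [apply Rabs_triang|].
    rewrite !Rmult_plus_distr_r. apply Rplus_le_compat.
    + eapply Rle_trans; [apply Rabs_triang|]. apply Rplus_le_compat.
      * rewrite Rabs_mult, Rmult_assoc.
        apply Rmult_le_compat; try apply Rabs_pos; lra.
      * rewrite Rabs_mult.
        replace (U * Q * V * x ^ 2) with ((U * x * Q) * (V * x)) by ring.
        apply Rmult_le_compat; try apply Rabs_pos; auto.
        eapply Rle_trans; [apply P0|].
        apply Rmult_le_compat; auto; [apply Rabs_pos|left; apply exp_pos].
    + rewrite Rabs_mult. apply Rmult_le_compat_l; auto.
Qed.

(** * Complex powers, rising factorials and the ratio of consecutive Euler terms *)

Lemma RCpow_plus (x : R) (s t : C) :
  RCpow x (s + t) = (RCpow x s * RCpow x t)%C.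
Proof.
  unfold RCpow. destruct s as [a b], t as [c d]. unfold Re, Im; simpl.
  rewrite !Rmult_plus_distr_r, exp_plus, cos_plus, sin_plus.
  apply injective_projections; simpl; ring.
Qed.

Lemma RCpow_mult (x y : R) (s : C) : 0 < x -> 0 < y ->
  RCpow (x * y) s = (RCpow x s * RCpow y s)%C.
Proof.
  intros Hx Hy. unfold RCpow. destruct s as [a b]. unfold Re, Im; simpl.
  rewrite ln_mult, !Rmult_plus_distr_l, exp_plus, cos_plus, sin_plus by auto.
  apply injective_projections; simpl; ring.
Qed.

Lemma RCpow_1_r (x : R) : 0 < x -> RCpow x (RtoC 1) = RtoC x.
Proof.
  intros Hx. unfold RCpow, Re, Im, RtoC; simpl.
  rewrite Rmult_1_l, Rmult_0_l, exp_ln, cos_0, sin_0 by auto.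
  apply injective_projections; simpl; ring.
Qed.

Lemma RtoC_neq_0 (x : R) : x <> 0 -> RtoC x <> RtoC 0.
Proof. intros H E. apply H. now apply RtoC_inj. Qed.

Lemma RtoC_S (k : nat) : RtoC (INR (S k)) = (RtoC (INR k) + 1)%C.
Proof. now rewrite S_INR, RtoC_plus. Qed.

Lemma not_nonpos_integer_plus_nat (s : C) (k : nat) :
  ~ nonpos_integer s -> ~ nonpos_integer (s + RtoC (INR k)).
Proof.
  intros H [n Hn]. apply H. exists (n + k)%nat.
  rewrite plus_INR, Ropp_plus_distr, RtoC_plus, <- Hn, RtoC_opp. ring.
Qed.

Lemma not_nonpos_integer_neq_0 (s : C) (k : nat) :
  ~ nonpos_integer s -> (s + RtoC (INR k))%C <> RtoC 0.
Proof.
  intros H E. apply H. exists k.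
  rewrite RtoC_opp. replace s with (s + RtoC (INR k) - RtoC (INR k))%C by ring.
  rewrite E. ring.
Qed.

(** For large [k] the modulus is at least [k - Cmod s]; the finitely many other indices are covered
    by a minimum, which is positive because no [s + k] vanishes. *)
Lemma Cmod_plus_nat_lower (s : C) : ~ nonpos_integer s ->
  exists c, 0 < c /\ forall k, c * (INR k + 1) <= Cmod (s + RtoC (INR k)).
Proof.
  intros Hs.
  assert (Hfin : forall K, exists c, 0 < c /\ forall k, (k < K)%nat ->
     c * (INR k + 1) <= Cmod (s + RtoC (INR k))).
  { induction K as [|K [c [Hc IH]]].
    - exists 1. split; [lra|]. intros; lia.
    - set (d := Cmod (s + RtoC (INR K)) / (INR K + 1)).
      assert (HK := pos_INR K).
      assert (Hd : 0 < d).
      { apply Rdiv_lt_0_compat; [|lra]. apply Cmod_gt_0.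
        now apply not_nonpos_integer_neq_0. }
      exists (Rmin c d). split; [now apply Rmin_pos|].
      intros k Hk. assert (Hk' := pos_INR k).
      destruct (Nat.eq_dec k K) as [->|n].
      + apply Rle_trans with (d * (INR K + 1)).
        * apply Rmult_le_compat_r; [lra|apply Rmin_r].
        * unfold d. right. field. lra.
      + apply Rle_trans with (c * (INR k + 1)); [|apply IH; lia].
        apply Rmult_le_compat_r; [lra|apply Rmin_l]. }
  destruct (INR_unbounded (2 * Cmod s + 1)) as [K HK].
  destruct (Hfin K) as [c [Hc H]].
  exists (Rmin c (/ 4)). split; [apply Rmin_pos; lra|].
  intros k. assert (Hk := pos_INR k).
  destruct (Nat.lt_ge_cases k K) as [h|h].
  - apply Rle_trans with (c * (INR k + 1)); [|now apply H].
    apply Rmult_le_compat_r; [lra|apply Rmin_l].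
  - apply Rle_trans with (/ 4 * (INR k + 1)).
    + apply Rmult_le_compat_r; [lra|apply Rmin_r].
    + apply le_INR in h. assert (H1 := Cmod_triangle_inv (RtoC (INR k)) s).
      rewrite Cmod_R, Rabs_pos_eq, Cplus_comm in H1 by auto.
      generalize (Cmod_ge_0 s). lra.
Qed.

Lemma Crising_neq_0 (s : C) (n : nat) :
  ~ nonpos_integer s -> Crising s n <> RtoC 0.
Proof.
  intros H. induction n as [|n IH]; simpl.
  - apply C1_nz.
  - apply Cmult_neq_0; auto. now apply not_nonpos_integer_neq_0.
Qed.

Lemma Crising_shift (s : C) (n : nat) :
  (s * Crising (s + 1) n = Crising s n * (s + RtoC (INR n)))%C.
Proof.
  induction n as [|n IH].
  - simpl. ring.
  - change (Crising (s + 1) (S n))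
      with (Crising (s + 1) n * (s + 1 + RtoC (INR n)))%C.
    change (Crising s (S n)) with (Crising s n * (s + RtoC (INR n)))%C.
    rewrite Cmult_assoc, IH, RtoC_S. ring.
Qed.

Lemma RtoC_fact_S (n : nat) :
  RtoC (INR (fact (S n))) = ((RtoC (INR n) + 1) * RtoC (INR (fact n)))%C.
Proof. now rewrite fact_simpl, mult_INR, RtoC_mult, RtoC_S. Qed.

Lemma Gamma_seq_S (s : C) (n : nat) : ~ nonpos_integer s ->
  Gamma_seq s (S (S n)) =
  (Gamma_seq s (S n) * ((RtoC (INR (S n)) + 1) * RCpow (1 + / INR (S n)) s
     / (s + RtoC (INR (S n)) + 1)))%C.
Proof.
  intros Hs. unfold Gamma_seq.
  rewrite RtoC_fact_S.
  assert (Hn : 0 < INR (S n)) by (apply lt_0_INR; lia).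
  assert (Hi : 0 < / INR (S n)) by now apply Rinv_0_lt_compat.
  replace (INR (S (S n))) with (INR (S n) * (1 + / INR (S n)))
    by (rewrite (S_INR (S n)); field; lra).
  rewrite RCpow_mult by lra.
  change (Crising s (S (S (S n))))
    with (Crising s (S (S n)) * (s + RtoC (INR (S (S n)))))%C.
  assert (H1 := Crising_neq_0 s (S (S n)) Hs).
  assert (H2 := not_nonpos_integer_neq_0 s (S (S n)) Hs).
  rewrite (RtoC_S (S n)) in *.
  field. split; auto. now rewrite <- Cplus_assoc.
Qed.

Lemma is_Clim_Gamma_seq (s : C) : ~ nonpos_integer s ->
  is_Clim (Gamma_seq s) (CGamma s).
Proof.
  intros Hs.
  assert (Hex : exists l, is_Clim (Gamma_seq s) l).
  { destruct (RCpow_taylor1 s) as [K [HK HT]].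
    destruct (Cmod_plus_nat_lower s Hs) as [c [Hc Hl]].
    assert (HB : 0 <= (Cmod s + 2 * K) / c).
    { apply Rmult_le_pos; [generalize (Cmod_ge_0 s); lra|].
      left. now apply Rinv_0_lt_compat. }
    (* The index starts at 1: at 0 the power has base 0, and the ratio of consecutive terms involves
       [1 / n]. *)
    destruct (is_Clim_of_ratio (fun n => Gamma_seq s (S n))
               ((Cmod s + 2 * K) / c) HB) as [l Hlim].
    - intros n. rewrite Gamma_seq_S by auto.
      set (g := Gamma_seq s (S n)).
      assert (Hn : 1 <= INR (S n))
        by (rewrite S_INR; generalize (pos_INR n); lra).
      replace (INR n + 1) with (INR (S n)) by apply S_INR.
      set (m := INR (S n)) in *.
      assert (Hne := not_nonpos_integer_neq_0 s (S (S n)) Hs).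
      assert (Hlow := Hl (S (S n))).
      rewrite (S_INR (S n)) in Hlow. rewrite (RtoC_S (S n)) in Hne.
      fold m in Hlow, Hne. rewrite RtoC_plus in Hlow.
      rewrite Cplus_assoc in Hne, Hlow.
      assert (Hi : 0 < / m) by (apply Rinv_0_lt_compat; lra).
      assert (Hi1 : / m <= 1) by (rewrite <- Rinv_1; apply Rinv_le_contravar; lra).
      specialize (HT (/ m) (conj (Rlt_le _ _ Hi) Hi1)).
      set (eps := (RCpow (1 + / m) s - (1 + s * RtoC (/ m)))%C) in *.
      assert (Hm : RtoC m <> RtoC 0) by (apply RtoC_neq_0; lra).
      (* The terms of order 1 cancel. The numerator left over is [O(1 / m)], since [eps] is
         quadratic in [1 / m], and the denominator is at least [c m]: together the required inverse
         square. *)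
      replace (g * ((RtoC m + 1) * RCpow (1 + / m) s / (s + RtoC m + 1)) - g)%C
        with (g * ((s * RtoC (/ m) + (RtoC m + 1) * eps)
                   / (s + RtoC m + 1)))%C.
      2:{ unfold eps. rewrite RtoC_inv by lra. field. now split. }
      rewrite Cmod_mult. apply Rmult_le_compat_l; [apply Cmod_ge_0|].
      rewrite Cmod_div by auto.
      assert (Hnum : Cmod (s * RtoC (/ m) + (RtoC m + 1) * eps)
                <= (Cmod s + 2 * K) / m).
      { eapply Rle_trans; [apply Cmod_triangle|].
        rewrite !Cmod_mult, <- RtoC_plus, !Cmod_R, !Rabs_pos_eq by lra.
        replace ((Cmod s + 2 * K) / m)
          with (Cmod s * / m + 2 * m * (K * (/ m) ^ 2)) by (field; lra).
        apply Rplus_le_compat_l. apply Rmult_le_compat; auto; try lra.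
        apply Cmod_ge_0. }
      replace ((Cmod s + 2 * K) / c / m ^ 2)
        with ((Cmod s + 2 * K) / m * / (c * m)) by (field; lra).
      apply Rmult_le_compat; auto.
      + apply Cmod_ge_0.
      + left. apply Rinv_0_lt_compat. now apply Cmod_gt_0.
      + apply Rinv_le_contravar; [nra|]. nra.
    - exists l. unfold is_Clim in *.
      now apply (is_lim_seq_incr_1 (fun n => Cmod (Gamma_seq s n - l))). }
  destruct Hex as [l Hl].
  replace (CGamma s) with l; auto.
  unfold CGamma.
  rewrite (is_lim_seq_unique _ _ (is_Clim_Re _ _ Hl)).
  rewrite (is_lim_seq_unique _ _ (is_Clim_Im _ _ Hl)).
  now destruct l.
Qed.

(** * Partial fractions of the truncated product *)

Lemma is_Clim_inv_plus_nat (w : C) : ~ nonpos_integer w ->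
  is_Clim (fun n => / (w + RtoC (INR n)))%C 0.
Proof.
  intros Hw. destruct (Cmod_plus_nat_lower w Hw) as [c [Hc Hl]].
  eapply is_lim_seq_le_0; [|apply (is_lim_seq_inv_S (/ c))].
  exists 0%nat. intros n _. split; [apply Cmod_ge_0|].
  replace (/ (w + RtoC (INR n)) - 0)%C with (/ (w + RtoC (INR n)))%C by ring.
  rewrite Cmod_inv by now apply not_nonpos_integer_neq_0.
  assert (Hn := pos_INR n).
  replace (/ c / (INR n + 1)) with (/ (c * (INR n + 1))) by (field; lra).
  apply Rinv_le_contravar; [nra|apply Hl].
Qed.

Lemma CGamma_succ (s : C) : ~ nonpos_integer s ->
  CGamma (s + 1) = (s * CGamma s)%C.
Proof.
  intros Hs.
  assert (Hs1 : ~ nonpos_integer (s + 1))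
    by (apply (not_nonpos_integer_plus_nat s 1 Hs)).
  apply is_Clim_unique with (Gamma_seq (s + 1)).
  { now apply is_Clim_Gamma_seq. }
  (* Up to the factor [s], the two Euler sequences differ by [n / (s + 1 + n)], written here as 1
     minus a term that tends to 0. *)
  apply (is_Clim_ext_loc (fun n => s * Gamma_seq s n
           * (1 - (s + 1) * / (s + 1 + RtoC (INR n))))%C).
  - exists 1%nat. intros n Hn. unfold Gamma_seq.
    assert (Hn' : 0 < INR n) by (apply lt_0_INR; lia).
    rewrite RCpow_plus, RCpow_1_r by auto.
    assert (E := Crising_shift s (S n)).
    assert (N1 := Crising_neq_0 s (S n) Hs).
    assert (N2 := Crising_neq_0 (s + 1) (S n) Hs1).
    assert (N3 := not_nonpos_integer_neq_0 (s + 1) n Hs1).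
    rewrite RtoC_S in E.
    assert (N0 : s <> RtoC 0).
    { intros E0. apply (not_nonpos_integer_neq_0 s 0 Hs).
      simpl. rewrite E0. ring. }
    replace (Crising s (S n))
      with (s * Crising (s + 1) (S n) / (s + 1 + RtoC (INR n)))%C.
    2:{ rewrite E. field. auto. }
    field. auto.
  - replace (s * CGamma s)%C with (s * CGamma s * (1 - (s + 1) * 0))%C by ring.
    apply is_Clim_mult; [apply is_Clim_scal; now apply is_Clim_Gamma_seq|].
    apply is_Clim_minus; [apply is_Clim_const|].
    apply is_Clim_scal. now apply is_Clim_inv_plus_nat.
Qed.

(* This is [Gamma_seq (s + k) n / k!] times [n! / ((n - k)! n ^ k)], a
   correction that tends to 1. *)
Definition residue_seq (s : C) (n k : nat) : C :=
  (RtoC (INR (fact n)) * RtoC (INR (fact n)) * RCpow (INR n) s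
   / (RtoC (INR (fact k)) * RtoC (INR (fact (n - k)))
      * Crising (s + RtoC (INR k)) (S n)))%C.

Lemma RtoC_fact_neq_0 (n : nat) : RtoC (INR (fact n)) <> RtoC 0.
Proof. apply RtoC_neq_0, INR_fact_neq_0. Qed.

Lemma RtoC_S_neq_0 (n : nat) : (RtoC (INR n) + 1)%C <> RtoC 0.
Proof. rewrite <- RtoC_S. apply RtoC_neq_0, not_0_INR. lia. Qed.

Lemma residue_seq_0 (s : C) (n : nat) : ~ nonpos_integer s ->
  residue_seq s n 0 = Gamma_seq s n.
Proof.
  intros Hs. unfold residue_seq, Gamma_seq.
  rewrite Nat.sub_0_r. simpl (INR 0). rewrite Cplus_0_r. simpl (fact 0).
  simpl (INR 1).
  assert (H1 := RtoC_fact_neq_0 n). assert (H2 := Crising_neq_0 s (S n) Hs).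
  field. auto.
Qed.

(** Source of all estimates on [residue_seq]: [(s + k) / (k + 1)] produces the growth [k ^ (s - 1)],
    and [(n - k) / (s + k + n + 1)] the Gaussian cutoff. *)
Lemma residue_seq_S (s : C) (n k : nat) : ~ nonpos_integer s -> (k < n)%nat ->
  residue_seq s n (S k) =
  (residue_seq s n k * ((RtoC (INR n) - RtoC (INR k)) * (s + RtoC (INR k))
     / ((RtoC (INR k) + 1) * (s + RtoC (INR k) + RtoC (INR n) + 1))))%C.
Proof.
  intros Hs Hk. unfold residue_seq.
  replace (n - k)%nat with (S (n - S k)) by lia.
  rewrite (RtoC_fact_S k), (RtoC_fact_S (n - S k)).
  rewrite minus_INR by lia. rewrite RtoC_minus.
  rewrite !(RtoC_S k).
  assert (E := Crising_shift (s + RtoC (INR k)) (S n)).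
  rewrite RtoC_S in E.
  assert (Hsk := not_nonpos_integer_plus_nat s k Hs).
  assert (Hsk1 := not_nonpos_integer_plus_nat s (S k) Hs).
  rewrite RtoC_S in Hsk1.
  assert (N1 := Crising_neq_0 _ (S n) Hsk).
  assert (N2 := Crising_neq_0 _ (S n) Hsk1).
  assert (N3 := not_nonpos_integer_neq_0 _ (S n) Hsk).
  assert (N4 := not_nonpos_integer_neq_0 s k Hs).
  assert (N5 := RtoC_S_neq_0 k).
  assert (N6 := RtoC_fact_neq_0 k).
  assert (N7 := RtoC_fact_neq_0 (n - S k)).
  assert (N8 : (RtoC (INR n) - RtoC (INR k))%C <> RtoC 0).
  { rewrite <- RtoC_minus. apply RtoC_neq_0.
    apply lt_INR in Hk. lra. }
  rewrite RtoC_S in N3. rewrite Cplus_assoc in N3.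
  rewrite <- Cplus_assoc in E.
  set (c1 := Crising (s + RtoC (INR k)) (S n)) in *.
  rewrite Cplus_assoc in N2. rewrite Cplus_assoc in *.
  set (c2 := Crising (s + RtoC (INR k) + 1) (S n)) in *.
  replace c1 with ((s + RtoC (INR k)) * c2
                   / (s + RtoC (INR k) + RtoC (INR n) + 1))%C.
  2:{ rewrite E. field. auto. }
  field. repeat split; auto.
  intro E'; apply N8; rewrite <- E'; ring.
Qed.

(** In the ratio from [k] to [k + 1] only [(n - k) / (s + k + n + 1)] depends on [n], and it tends
    to 1; the rest is one step of the functional equation over one step of the factorial. *)
Lemma is_Clim_residue_seq (s : C) (k : nat) : ~ nonpos_integer s ->
  is_Clim (fun n => residue_seq s n k)
    (CGamma (s + RtoC (INR k)) / RtoC (INR (fact k)))%C.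
Proof.
  intros Hs. induction k as [|k IH].
  - simpl. replace (CGamma (s + 0) / 1)%C with (CGamma s)
      by (rewrite Cplus_0_r; field).
    apply (is_Clim_ext_loc (Gamma_seq s)); [|now apply is_Clim_Gamma_seq].
    exists 0%nat. intros n _. now rewrite residue_seq_0.
  - assert (Hsk := not_nonpos_integer_plus_nat s k Hs).
    assert (Hsk1 := not_nonpos_integer_plus_nat s (S k) Hs).
    apply (is_Clim_ext_loc (fun n => residue_seq s n k
      * ((s + RtoC (INR k)) / (RtoC (INR k) + 1)
         * (1 - (s + 2 * RtoC (INR k) + 1)
                * / (s + RtoC (INR (S k)) + RtoC (INR n)))))%C).
    + exists (S k). intros n Hn. rewrite residue_seq_S by (auto; lia).
      f_equal. assert (N5 := RtoC_S_neq_0 k).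
      assert (N := not_nonpos_integer_neq_0 _ n Hsk1).
      rewrite RtoC_S in *. field. repeat split; auto.
      intro E; apply N; rewrite <- E; ring.
    + rewrite RtoC_S, Cplus_assoc, CGamma_succ, RtoC_fact_S by auto.
      replace ((s + RtoC (INR k)) * CGamma (s + RtoC (INR k))
               / ((RtoC (INR k) + 1) * RtoC (INR (fact k))))%C
        with (CGamma (s + RtoC (INR k)) / RtoC (INR (fact k))
          * ((s + RtoC (INR k)) / (RtoC (INR k) + 1)
             * (1 - (s + 2 * RtoC (INR k) + 1) * 0)))%C.
      2:{ field. split; [apply RtoC_fact_neq_0|apply RtoC_S_neq_0]. }
      apply is_Clim_mult; auto. apply is_Clim_scal.
      apply is_Clim_minus; [apply is_Clim_const|]. apply is_Clim_scal.
      rewrite <- Cplus_assoc, <- RtoC_S. now apply is_Clim_inv_plus_nat.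
Qed.

(** * Finite complex sums and the partial fraction identity *)

Definition Csum (f : nat -> C) (n : nat) : C :=
  sum_n (G := C_AbelianMonoid) f n.

Lemma Csum_ext (f g : nat -> C) (n : nat) :
  (forall k, (k <= n)%nat -> f k = g k) -> Csum f n = Csum g n.
Proof. apply (sum_n_ext_loc (G := C_AbelianMonoid)). Qed.

Lemma Csum_S (f : nat -> C) (n : nat) :
  Csum f (S n) = (Csum f n + f (S n))%C.
Proof. exact (sum_Sn (G := C_AbelianMonoid) f n). Qed.

Lemma Csum_0 (f : nat -> C) : Csum f 0 = f 0%nat.
Proof. exact (sum_O (G := C_AbelianMonoid) f). Qed.

Lemma Csum_scal_minus (d : C) (f g : nat -> C) (n : nat) :
  Csum (fun k => d * (f k - g k))%C n = (d * (Csum f n - Csum g n))%C.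
Proof.
  induction n as [|n IH].
  - now rewrite !Csum_0.
  - rewrite !Csum_S, IH. ring.
Qed.

Lemma Csum_scal (d : C) (f : nat -> C) (n : nat) :
  Csum (fun k => d * f k)%C n = (d * Csum f n)%C.
Proof.
  induction n as [|n IH].
  - now rewrite !Csum_0.
  - rewrite !Csum_S, IH. ring.
Qed.

Lemma Crising_neg_nat (m j : nat) : (j <= m)%nat ->
  (Crising (- RtoC (INR m)) j * RtoC (INR (fact (m - j)))
   = (-(1)) ^ j * RtoC (INR (fact m)))%C.
Proof.
  induction j as [|j IH]; intros Hj.
  - simpl. rewrite Nat.sub_0_r. ring.
  - rewrite Cpow_S, <- Cmult_assoc, <- IH by lia.
    replace (m - j)%nat with (S (m - S j)) by lia.
    rewrite RtoC_fact_S, minus_INR, RtoC_minus, RtoC_S by lia.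
    simpl. ring.
Qed.

(** Closed form of the Lagrange coefficient, the product over [j <= n], [j <> k], of
    [1 / ((a + j) ^ 2 - (a + k) ^ 2)]. Each denominator is [(j - k) (2 a + k + j)]; the first
    factors multiply to [(-1) ^ k k! (n - k)!], the second to the rising factorial without its
    factor [2 (a + k)]. *)
Definition pf_coef (a : C) (n k : nat) : C :=
  ((-(1)) ^ k * (2 * (a + RtoC (INR k)))
   / (RtoC (INR (fact k)) * RtoC (INR (fact (n - k)))
      * Crising (2 * a + RtoC (INR k)) (S n)))%C.

Lemma pf_coef_S (a : C) (n k : nat) :
  ~ nonpos_integer (2 * a) -> (k <= n)%nat ->
  pf_coef a (S n) k =
  (pf_coef a n k
   / ((a + RtoC (INR (S n))) ^ 2 - (a + RtoC (INR k)) ^ 2))%C.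
Proof.
  intros H Hk. unfold pf_coef.
  replace (S n - k)%nat with (S (n - k)) by lia.
  rewrite RtoC_fact_S, minus_INR, RtoC_minus by lia.
  change (Crising (2 * a + RtoC (INR k)) (S (S n)))
    with (Crising (2 * a + RtoC (INR k)) (S n)
          * (2 * a + RtoC (INR k) + RtoC (INR (S n))))%C.
  assert (Hs := not_nonpos_integer_plus_nat _ k H).
  assert (N1 := Crising_neq_0 _ (S n) Hs).
  assert (N2 := not_nonpos_integer_neq_0 _ (S n) Hs).
  assert (N3 := RtoC_fact_neq_0 k).
  assert (N4 := RtoC_fact_neq_0 (n - k)).
  assert (N5 : (RtoC (INR n) - RtoC (INR k) + 1)%C <> RtoC 0).
  { rewrite <- RtoC_minus, <- RtoC_plus. apply RtoC_neq_0.
    apply le_INR in Hk. lra. }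
  rewrite RtoC_S in *.
  set (c := Crising (2 * a + RtoC (INR k)) (S n)) in *.
  replace ((a + (RtoC (INR n) + 1)) ^ 2 - (a + RtoC (INR k)) ^ 2)%C
    with ((RtoC (INR n) - RtoC (INR k) + 1)
          * (2 * a + RtoC (INR k) + (RtoC (INR n) + 1)))%C by ring.
  field. repeat split; auto.
Qed.

(** The right side is the inverse of the product of two rising factorials of length [n] at
    [z = a + n], where [a + z = 2 a + n] and [a - z = - n]. In this form the interpolation step
    meets the coefficient. *)
Lemma pf_coef_diag (a : C) (n : nat) : ~ nonpos_integer (2 * a) ->
  pf_coef a n n =
  (/ (Crising (2 * a + RtoC (INR n)) n * Crising (- RtoC (INR n)) n))%C.
Proof.
  intros H. unfold pf_coef.
  assert (E := Crising_neg_nat n n (Nat.le_refl n)).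
  rewrite Nat.sub_diag in *. simpl (INR (fact 0)) in *.
  rewrite Cmult_1_r in E. rewrite E.
  assert (Hs := not_nonpos_integer_plus_nat _ n H).
  assert (N1 := Crising_neq_0 _ n Hs).
  assert (N2 := not_nonpos_integer_neq_0 _ n Hs).
  assert (N3 := RtoC_fact_neq_0 n).
  assert (N4 : ((-(1)) ^ n * (-(1)) ^ n)%C = RtoC 1).
  { rewrite <- Cpow_mult_l. replace (-(1) * -(1))%C with (RtoC 1) by ring.
    apply Cpow_1_l. }
  assert (N5 : ((-(1)) ^ n)%C <> RtoC 0).
  { intros E0. rewrite E0 in N4. apply C1_nz. rewrite <- N4. ring. }
  change (Crising (2 * a + RtoC (INR n)) (S n))
    with (Crising (2 * a + RtoC (INR n)) n
          * (2 * a + RtoC (INR n) + RtoC (INR n)))%C.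
  set (c := Crising (2 * a + RtoC (INR n)) n) in *.
  set (e := ((-(1)) ^ n)%C) in *.
  replace (e * (2 * (a + RtoC (INR n))))%C
    with (e * e * (2 * (a + RtoC (INR n))) / e)%C by (field; auto).
  rewrite N4. field. repeat split; auto.
Qed.

(* Lagrange interpolation: the coefficient at the new node is forced by the
   identity for [n] evaluated at [z = a + n + 1]. *)
Lemma Crising_partial_fractions (a : C) (n : nat) :
  ~ nonpos_integer (2 * a) -> forall z : C,
  (forall k, (k <= n)%nat -> (a + z + RtoC (INR k))%C <> RtoC 0) ->
  (forall k, (k <= n)%nat -> (a - z + RtoC (INR k))%C <> RtoC 0) ->
  (/ (Crising (a + z) (S n) * Crising (a - z) (S n)))%C =
  Csum (fun k => pf_coef a n k / ((a + RtoC (INR k)) ^ 2 - z ^ 2))%C n.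
Proof.
  (* The induction hypothesis must be usable at [z = a + n + 1], where [a - z] is a nonpositive
     integer. Hence [z] stays general and nonvanishing is asked only for the indices up to [n]. *)
  intros Ha. induction n as [|n IH]; intros z Hp Hm.
  - rewrite Csum_0. unfold pf_coef. simpl.
    assert (N1 := Hp O (Nat.le_refl _)). assert (N2 := Hm O (Nat.le_refl _)).
    assert (N3 := not_nonpos_integer_neq_0 _ 0 Ha).
    simpl in *. rewrite Cplus_0_r in *.
    assert (N4 : (a * (a * 1) - z * (z * 1))%C <> RtoC 0).
    { replace (a * (a * 1) - z * (z * 1))%C with ((a + z) * (a - z))%C by ring.
      now apply Cmult_neq_0. }
    replace (a * (a * 1) - z * (z * 1))%C with ((a + z) * (a - z))%C by ring.
    field. repeat split; auto.
    + intro E; apply N3; rewrite E; ring.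
    + intro E; apply N4; rewrite <- E; ring.
  - rewrite Csum_S.
    assert (Np := Hp (S n) (Nat.le_refl _)).
    assert (Nm := Hm (S n) (Nat.le_refl _)).
    assert (NX : ((a + RtoC (INR (S n))) ^ 2 - z ^ 2)%C <> RtoC 0).
    { replace ((a + RtoC (INR (S n))) ^ 2 - z ^ 2)%C
        with ((a + z + RtoC (INR (S n))) * (a - z + RtoC (INR (S n))))%C by ring.
      now apply Cmult_neq_0. }
    (* With [X], [Y], [W] the squares of [a + n + 1], [a + k], [z]: [1 / ((X - Y) (Y - W))] is
       [1 / (X - W)] times [1 / (Y - W) - 1 / (Y - X)]. The old terms thus sum to a difference of
       two instances of the induction hypothesis, and the second cancels the new term. *)
    rewrite (Csum_ext _
      (fun k => / ((a + RtoC (INR (S n))) ^ 2 - z ^ 2)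
        * (pf_coef a n k / ((a + RtoC (INR k)) ^ 2 - z ^ 2)
           - pf_coef a n k / ((a + RtoC (INR k)) ^ 2
                              - (a + RtoC (INR (S n))) ^ 2)))%C).
    + rewrite Csum_scal_minus, <- !IH.
      * replace (a + (a + RtoC (INR (S n))))%C
          with (2 * a + RtoC (INR (S n)))%C by ring.
        replace (a - (a + RtoC (INR (S n))))%C
          with (- RtoC (INR (S n)))%C by ring.
        rewrite pf_coef_diag by auto.
        change (Crising (a + z) (S (S n)))
          with (Crising (a + z) (S n) * (a + z + RtoC (INR (S n))))%C.
        change (Crising (a - z) (S (S n)))
          with (Crising (a - z) (S n) * (a - z + RtoC (INR (S n))))%C.
        assert (Hc : forall w, (forall k, (k <= n)%nat ->
                  (w + RtoC (INR k))%C <> RtoC 0) ->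
                  forall j, (j <= S n)%nat -> Crising w j <> RtoC 0).
        { intros w Hw j. induction j as [|j IHj]; intros Hj; simpl.
          - apply C1_nz.
          - apply Cmult_neq_0; [apply IHj; lia|apply Hw; lia]. }
        assert (N1 := Hc (a + z)%C (fun k Hk => Hp k ltac:(lia)) (S n)
                         (Nat.le_refl _)).
        assert (N2 := Hc (a - z)%C (fun k Hk => Hm k ltac:(lia)) (S n)
                         (Nat.le_refl _)).
        unfold Cdiv.
        set (A := (/ (Crising (2 * a + RtoC (INR (S n))) (S n)
                      * Crising (- RtoC (INR (S n))) (S n)))%C).
        replace ((a + RtoC (INR (S n))) ^ 2 - z ^ 2)%C
        with ((a + z + RtoC (INR (S n))) * (a - z + RtoC (INR (S n))))%C by ring.
        field. repeat split; auto.
      * intros k Hk.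
        replace (a + (a + RtoC (INR (S n))) + RtoC (INR k))%C
          with (2 * a + RtoC (INR (S n + k)))%C
          by (rewrite plus_INR, RtoC_plus; ring).
        now apply not_nonpos_integer_neq_0.
      * intros k Hk.
        replace (a - (a + RtoC (INR (S n))) + RtoC (INR k))%C
          with (RtoC (INR k - INR (S n))) by (rewrite RtoC_minus; ring).
        apply RtoC_neq_0. assert (Hk' : (k < S n)%nat) by lia.
        apply lt_INR in Hk'. lra.
      * intros k Hk. apply Hp. lia.
      * intros k Hk. apply Hm. lia.
    + intros k Hk. rewrite pf_coef_S by auto.
      assert (Nk : ((a + RtoC (INR k)) ^ 2 - z ^ 2)%C <> RtoC 0).
      { replace ((a + RtoC (INR k)) ^ 2 - z ^ 2)%C
          with ((a + z + RtoC (INR k)) * (a - z + RtoC (INR k)))%C by ring.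
        apply Cmult_neq_0; [apply Hp|apply Hm]; lia. }
      assert (Nx : ((a + RtoC (INR (S n))) ^ 2 - (a + RtoC (INR k)) ^ 2)%C
                   <> RtoC 0).
      { replace ((a + RtoC (INR (S n))) ^ 2 - (a + RtoC (INR k)) ^ 2)%C
          with (RtoC (INR (S n) - INR k) * (2 * a + RtoC (INR (S n + k))))%C
          by (rewrite plus_INR, RtoC_plus, RtoC_minus; ring).
        apply Cmult_neq_0; [|now apply not_nonpos_integer_neq_0].
        apply RtoC_neq_0. assert (Hk' : (k < S n)%nat) by lia.
        apply lt_INR in Hk'. lra. }
      set (X := ((a + RtoC (INR (S n))) ^ 2)%C) in *.
      set (Y := ((a + RtoC (INR k)) ^ 2)%C) in *.
      set (W := (z ^ 2)%C) in *.
      field. repeat split; auto.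
      intro E; apply Nx.
      replace (X - Y)%C with (- (Y - X))%C by ring. rewrite E. ring.
Qed.

(** What the subtraction at [z = 0] leaves: [2 (a + k)] times [1 / ((a + k) ^ 2 - z ^ 2) - 1 / (a +
    k) ^ 2] is [2 z ^ 2] times this weight, which decays like [k ^ (-3)]. *)
Definition weight (a z : C) (k : nat) : C :=
  (/ ((a + RtoC (INR k)) * (a + z + RtoC (INR k)) * (a - z + RtoC (INR k))))%C.

Lemma Gamma_seq_product (a z : C) (n : nat) :
  ~ nonpos_integer (2 * a) -> ~ nonpos_integer (a + z) ->
  ~ nonpos_integer (a - z) ->
  (Gamma_seq (a + z) n * Gamma_seq (a - z) n)%C =
  Csum (fun k => (-(1)) ^ k * (2 * (a + RtoC (INR k)))
          * residue_seq (2 * a) n k / ((a + RtoC (INR k)) ^ 2 - z ^ 2))%C n.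
Proof.
  intros H2 Hp Hm.
  assert (P := Crising_partial_fractions a n H2 z
    (fun k _ => not_nonpos_integer_neq_0 _ k Hp)
    (fun k _ => not_nonpos_integer_neq_0 _ k Hm)).
  assert (N1 := Crising_neq_0 _ (S n) Hp).
  assert (N2 := Crising_neq_0 _ (S n) Hm).
  transitivity (RtoC (INR (fact n)) * RtoC (INR (fact n))
    * RCpow (INR n) (2 * a)
    * / (Crising (a + z) (S n) * Crising (a - z) (S n)))%C.
  - unfold Gamma_seq. replace (2 * a)%C with ((a + z) + (a - z))%C by ring.
    rewrite (RCpow_plus _ (a + z) (a - z)). field. auto.
  - rewrite P, <- Csum_scal. apply Csum_ext. intros k _.
    unfold pf_coef, residue_seq, Cdiv. ring.
Qed.

Lemma Gamma_seq_product_minus_square (a z : C) (n : nat) :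
  ~ nonpos_integer a -> ~ nonpos_integer (2 * a) ->
  ~ nonpos_integer (a + z) -> ~ nonpos_integer (a - z) ->
  (Gamma_seq (a + z) n * Gamma_seq (a - z) n - Gamma_seq a n * Gamma_seq a n)%C
  = (2 * z ^ 2
     * Csum (fun k => (-(1)) ^ k * (residue_seq (2 * a) n k * weight a z k)) n)%C.
Proof.
  intros Ha H2 Hp Hm.
  assert (P := Gamma_seq_product a z n H2 Hp Hm).
  assert (P0 := Gamma_seq_product a 0 n H2).
  rewrite Cplus_0_r in P0. replace (a - 0)%C with a in P0 by ring.
  rewrite P, (P0 Ha Ha).
  transitivity (1 * (Csum (fun k => (-(1)) ^ k * (2 * (a + RtoC (INR k)))
          * residue_seq (2 * a) n k / ((a + RtoC (INR k)) ^ 2 - z ^ 2))%C n -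
     Csum (fun k => (-(1)) ^ k * (2 * (a + RtoC (INR k)))
          * residue_seq (2 * a) n k / ((a + RtoC (INR k)) ^ 2 - 0 ^ 2))%C n))%C.
  { ring. }
  rewrite <- Csum_scal_minus, <- Csum_scal. apply Csum_ext. intros k _.
  unfold weight.
  assert (N1 := not_nonpos_integer_neq_0 _ k Ha).
  assert (N2 := not_nonpos_integer_neq_0 _ k Hp).
  assert (N3 := not_nonpos_integer_neq_0 _ k Hm).
  replace ((a + RtoC (INR k)) ^ 2 - z ^ 2)%C
    with ((a + z + RtoC (INR k)) * (a - z + RtoC (INR k)))%C by ring.
  replace ((a + RtoC (INR k)) ^ 2 - 0 ^ 2)%C
    with ((a + RtoC (INR k)) * (a + RtoC (INR k)))%C by ring.
  field. auto.
Qed.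

(** * Summation by parts and dominated convergence *)

Fixpoint sum_lt (f : nat -> R) (n : nat) : R :=
  match n with
  | O => 0
  | S m => sum_lt f m + f m
  end.

(** Since the majorant telescopes, the tail beyond [K] is at most [F K] for every [n]; the first [K]
    terms tend to 0 one by one. *)
Lemma is_lim_seq_sum_lt_dominated (f : nat -> nat -> R) (F : nat -> R) (N : nat) :
  (forall n k, 0 <= f n k) ->
  (forall n k, (N <= n)%nat -> (k < n)%nat -> f n k <= F k - F (S k)) ->
  (forall k, 0 <= F k) -> is_lim_seq F 0 ->
  (forall k, is_lim_seq (fun n => f n k) 0) ->
  is_lim_seq (fun n => sum_lt (f n) n) 0.
Proof.
  intros Hf HF HF0 HlF Hl.
  assert (Hpos : forall n m, 0 <= sum_lt (f n) m).
  { intros n m. induction m as [|m IH]; simpl; [lra|].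
    generalize (Hf n m); lra. }
  assert (Hfin : forall K, is_lim_seq (fun n => sum_lt (f n) K) 0).
  { induction K as [|K IH]; simpl; [apply is_lim_seq_const|].
    replace 0 with (0 + 0) by ring. now apply is_lim_seq_plus'. }
  assert (Htail : forall n K j, (N <= n)%nat -> (K + j <= n)%nat ->
    sum_lt (f n) (K + j) <= sum_lt (f n) K + F K - F (K + j)%nat).
  { intros n K j Hn. induction j as [|j IH]; intros Hj.
    - rewrite Nat.add_0_r. lra.
    - rewrite Nat.add_succ_r. simpl.
      assert (H1 := HF n (K + j)%nat Hn ltac:(lia)).
      assert (H2 := IH ltac:(lia)). lra. }
  apply is_lim_seq_spec. intros eps.
  apply is_lim_seq_spec in HlF.
  destruct (HlF (pos_div_2 eps)) as [K HK].
  specialize (HK K (Nat.le_refl _)). simpl in HK.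
  rewrite Rminus_0_r, Rabs_pos_eq in HK by apply HF0.
  specialize (Hfin K). apply is_lim_seq_spec in Hfin.
  destruct (Hfin (pos_div_2 eps)) as [N1 HN1].
  exists (N + K + N1)%nat. intros n Hn.
  specialize (HN1 n ltac:(lia)). simpl in HN1.
  rewrite Rminus_0_r, Rabs_pos_eq in HN1 by apply Hpos.
  rewrite Rminus_0_r, Rabs_pos_eq by apply Hpos.
  assert (Ht := Htail n K (n - K)%nat ltac:(lia) ltac:(lia)).
  replace (K + (n - K))%nat with n in Ht by lia.
  generalize (HF0 n). lra.
Qed.

Lemma Cmod_sign (k : nat) : Cmod ((-(1)) ^ k) = 1.
Proof. now rewrite Cmod_pow, Cmod_m1, pow1. Qed.

(** Twice the alternating sum is [f 0 + (-1) ^ n f n] plus the alternating sum of the differences.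
    Doubling avoids pairing neighbours according to the parity of [n]. *)
Lemma alternating_sum_by_parts (f : nat -> C) (n : nat) :
  Cmod (2 * Csum (fun k => (-(1)) ^ k * f k) n - f O - (-(1)) ^ n * f n)%C
  <= sum_lt (fun k => Cmod (f k - f (S k))) n.
Proof.
  induction n as [|n IH].
  - rewrite Csum_0. simpl.
    replace (2 * (1 * f O) - f O - 1 * f O)%C with (RtoC 0) by ring.
    rewrite Cmod_0. lra.
  - rewrite Csum_S. simpl sum_lt.
    replace (2 * (Csum (fun k => (-(1)) ^ k * f k) n + (-(1)) ^ S n * f (S n))
             - f O - (-(1)) ^ S n * f (S n))%C
      with ((2 * Csum (fun k => (-(1)) ^ k * f k) n - f O - (-(1)) ^ n * f n)
            + (-(1)) ^ n * (f n - f (S n)))%C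
      by (rewrite Cpow_S; ring).
    eapply Rle_trans; [apply Cmod_triangle|].
    rewrite Cmod_mult, Cmod_sign. lra.
Qed.

Lemma is_Clim_Cmod_le (u : nat -> C) (l : C) (b : R) :
  is_Clim u l -> eventually (fun n => Cmod (u n) <= b) -> Cmod l <= b.
Proof.
  intros Hu Hb.
  apply (is_lim_seq_le_loc (fun n => Cmod (u n)) (fun _ => b) (Cmod l) b); auto.
  - now apply is_Clim_Cmod.
  - apply is_lim_seq_const.
Qed.

(** Dominated convergence is applied to the differences in [k], after summation by parts. The bounds
    pass to the limit [T], so [T - t] obeys them with [2 F]. *)
Lemma alternating_tannery (t : nat -> nat -> C) (T : nat -> C) (F : nat -> R)
  (N : nat) :
  (forall k, is_Clim (fun n => t n k) (T k)) ->
  (forall n k, (N <= n)%nat -> (k <= n)%nat -> Cmod (t n k) <= F k) ->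
  (forall n k, (N <= n)%nat -> (k < n)%nat ->
     Cmod (t n k - t n (S k)) <= F k - F (S k)) ->
  is_lim_seq F 0 ->
  is_Clim (fun n => Csum (fun k => (-(1)) ^ k * T k) n
                    - Csum (fun k => (-(1)) ^ k * t n k) n)%C 0.
Proof.
  intros HT Hb Hd HF.
  assert (HTb : forall k, Cmod (T k) <= F k).
  { intros k. apply (is_Clim_Cmod_le (fun n => t n k)); auto.
    exists (N + k)%nat. intros n Hn. apply Hb; lia. }
  assert (HTd : forall k, Cmod (T k - T (S k)) <= F k - F (S k)).
  { intros k. apply (is_Clim_Cmod_le (fun n => t n k - t n (S k))%C).
    - now apply is_Clim_minus.
    - exists (S (N + k)). intros n Hn. apply Hd; lia. }
  assert (HF0 : forall k, 0 <= F k).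
  { intros k. eapply Rle_trans; [apply Cmod_ge_0|apply HTb]. }
  set (e := fun n k => (T k - t n k)%C).
  assert (He : forall k, is_lim_seq (fun n => Cmod (e n k)) 0).
  { intros k. replace 0 with (Cmod (T k - T k)).
    - apply is_Clim_Cmod. apply is_Clim_minus; [apply is_Clim_const|apply HT].
    - replace (T k - T k)%C with (RtoC 0) by ring. apply Cmod_0. }
  (* The boundary term [e n n] moves with [n], so pointwise convergence says nothing about it; it is
     bounded by [2 * F n] instead. *)
  eapply is_lim_seq_le_0 with (v := fun n =>
    sum_lt (fun k => Cmod (e n k - e n (S k))) n + Cmod (e n O) + 2 * F n).
  - exists N. intros n Hn. split; [apply Cmod_ge_0|].
    set (Sg := (Csum (fun k => (-(1)) ^ k * T k) n
                - Csum (fun k => (-(1)) ^ k * t n k) n - 0)%C).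
    assert (HS : Sg = Csum (fun k => (-(1)) ^ k * e n k)%C n).
    { transitivity (1 * (Csum (fun k => (-(1)) ^ k * T k) n
                - Csum (fun k => (-(1)) ^ k * t n k) n))%C; [unfold Sg; ring|].
      rewrite <- Csum_scal_minus. apply Csum_ext. intros k _. unfold e. ring. }
    assert (H := alternating_sum_by_parts (e n) n). rewrite <- HS in H.
    set (r := (2 * Sg - e n O - (-(1)) ^ n * e n n)%C) in *.
    assert (H2 : 2 * Cmod Sg <= Cmod r + (Cmod (e n O) + Cmod (e n n))).
    { replace (2 * Cmod Sg) with (Cmod (2 * Sg))
        by (rewrite Cmod_mult, Cmod_R, Rabs_pos_eq; lra).
      replace (2 * Sg)%C with (r + (e n O + (-(1)) ^ n * e n n))%C
        by (unfold r; ring).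
      eapply Rle_trans; [apply Cmod_triangle|]. apply Rplus_le_compat_l.
      eapply Rle_trans; [apply Cmod_triangle|]. apply Rplus_le_compat_l.
      rewrite Cmod_mult, Cmod_sign. lra. }
    assert (H3 : Cmod (e n n) <= F n + F n).
    { unfold e. eapply Rle_trans; [apply Cmod_triangle|].
      rewrite Cmod_opp. apply Rplus_le_compat; auto. }
    generalize (Cmod_ge_0 Sg). lra.
  - replace 0 with (0 + 0 + 2 * 0) by ring.
    apply is_lim_seq_plus'; [apply is_lim_seq_plus'|].
    + apply is_lim_seq_sum_lt_dominated with (fun k => 2 * F k) N.
      * intros; apply Cmod_ge_0.
      * intros n k Hn Hk.
        replace (e n k - e n (S k))%C
          with ((T k - T (S k)) + - (t n k - t n (S k)))%C by (unfold e; ring).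
        eapply Rle_trans; [apply Cmod_triangle|].
        rewrite Cmod_opp. generalize (HTd k), (Hd n k Hn Hk). lra.
      * intros k. generalize (HF0 k). lra.
      * replace 0 with (2 * 0) by ring.
        now apply (is_lim_seq_scal_l F 2 0).
      * intros k. replace 0 with (Cmod ((T k - T k) - (T (S k) - T (S k)))).
        -- apply is_Clim_Cmod.
           apply is_Clim_minus; apply is_Clim_minus;
             auto; apply is_Clim_const.
        -- replace ((T k - T k) - (T (S k) - T (S k)))%C with (RtoC 0) by ring.
           apply Cmod_0.
    + apply He.
    + now apply (is_lim_seq_scal_l F 2 0).
Qed.

(* A stand-in for [k ^ (-e)] whose increments are exact. *)
Fixpoint decay (e : R) (k : nat) : R :=
  match k with
  | O => 1
  | S m => decay e m * (1 - e / (INR m + 1))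
  end.

Lemma decay_pos (e : R) (k : nat) : 0 < e <= 1 / 2 -> 0 < decay e k.
Proof.
  intros He. induction k as [|k IH]; simpl; [lra|].
  apply Rmult_lt_0_compat; auto. assert (Hk := pos_INR k).
  assert (e / (INR k + 1) <= e / 1).
  { apply Rmult_le_compat_l; [lra|]. apply Rinv_le_contravar; lra. }
  lra.
Qed.

Lemma decay_diff (e : R) (k : nat) :
  decay e k - decay e (S k) = e * (decay e k / (INR k + 1)).
Proof. simpl. generalize (pos_INR k). intros. field. lra. Qed.

Lemma decay_decr (e : R) (k j : nat) : 0 < e <= 1 / 2 ->
  decay e (k + j) <= decay e k.
Proof.
  intros He. induction j as [|j IH]; [rewrite Nat.add_0_r; lra|].
  rewrite Nat.add_succ_r. assert (H := decay_diff e (k + j)).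
  assert (Hp := decay_pos e (k + j) He).
  assert (Hk := pos_INR (k + j)).
  assert (0 <= e * (decay e (k + j) / (INR (k + j) + 1))).
  { apply Rmult_le_pos; [lra|]. apply Rmult_le_pos; [lra|].
    left. apply Rinv_0_lt_compat. lra. }
  lra.
Qed.

(** The divergence of the harmonic series in doubling form: each of the [n] steps from [n] to [2 n]
    loses at least [e decay (2 n) / (2 n)], so the limit [l] satisfies [e / 2 * l <= l - l]. *)
Lemma is_lim_seq_decay (e : R) : 0 < e <= 1 / 2 -> is_lim_seq (decay e) 0.
Proof.
  intros He.
  destruct (ex_finite_lim_seq_decr (decay e) 0) as [l Hl].
  { intros n. generalize (decay_decr e n 1 He).
    now rewrite Nat.add_1_r. }
  { intros n. left. now apply decay_pos. }
  assert (Hl0 : 0 <= l).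
  { apply (is_lim_seq_le (fun _ => 0) (decay e) 0 l); auto.
    - intros n. left. now apply decay_pos.
    - apply is_lim_seq_const. }
  assert (H2 : is_lim_seq (fun n => decay e (n + n)) l).
  { apply (is_lim_seq_subseq (decay e) l (fun n => n + n)%nat); auto.
    apply eventually_subseq. intros n. lia. }
  assert (Hdbl : forall n j, (j <= n)%nat -> (0 < n)%nat ->
    INR j * (e * decay e (n + n) / INR (n + n)) <= decay e n - decay e (n + j)).
  { intros n j Hj Hn. induction j as [|j IH].
    - rewrite Nat.add_0_r. simpl. lra.
    - rewrite Nat.add_succ_r, S_INR.
      assert (H := decay_diff e (n + j)).
      assert (Hle : e * decay e (n + n) / INR (n + n)
                <= e * (decay e (n + j) / (INR (n + j) + 1))).
      { unfold Rdiv. rewrite Rmult_assoc. apply Rmult_le_compat_l; [lra|].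
        apply Rmult_le_compat.
        - left. now apply decay_pos.
        - left. apply Rinv_0_lt_compat, lt_0_INR. lia.
        - replace (n + n)%nat with ((n + j) + (n - j))%nat by lia.
          now apply decay_decr.
        - rewrite <- S_INR. apply Rinv_le_contravar.
          + apply lt_0_INR. lia.
          + apply le_INR. lia. }
      specialize (IH ltac:(lia)). lra. }
  assert (Hll : e / 2 * l <= l - l).
  { apply (is_lim_seq_le_loc (fun n => e / 2 * decay e (n + n))
      (fun n => decay e n - decay e (n + n)) (e / 2 * l) (l - l)).
    - exists 1%nat. intros n Hn.
      assert (H := Hdbl n n (Nat.le_refl _) ltac:(lia)).
      rewrite plus_INR in H.
      assert (0 < INR n) by (apply lt_0_INR; lia).
      eapply Rle_trans; [|exact H]. right. field. lra.
    - now apply (is_lim_seq_scal_l _ (e / 2) l).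
    - now apply is_lim_seq_minus'. }
  assert (l = 0) by nra. now subst l.
Qed.

(** * Uniform bounds for the truncated terms *)

(** The constant term must be [Re s]: the triangle inequality would give [Cmod s] and so the wrong
    growth exponent for complex [s]. *)
Lemma Cmod_plus_nat_upper (s : C) :
  exists B, 0 <= B /\ forall k,
    Cmod (s + RtoC (INR k)) <= INR k + Re s + B / (INR k + 1).
Proof.
  set (u := Re s). set (v := Im s).
  assert (Hu : Rabs u <= Cmod s) by apply re_le_Cmod.
  assert (Hm := Cmod_ge_0 s).
  exists (v ^ 2 + 2 * Cmod s * (2 * (1 + Rabs u))).
  assert (Hr := Rabs_pos u).
  assert (Hq : 0 <= 2 * Cmod s * (2 * (1 + Rabs u))) by (apply Rmult_le_pos; lra).
  assert (Hv : 0 <= v ^ 2) by nra.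
  split; [lra|].
  intros k. assert (Hk := pos_INR k).
  set (m := INR k + 1). assert (Hm1 : 1 <= m) by (unfold m; lra).
  assert (Hi : 0 < / m) by (apply Rinv_0_lt_compat; lra).
  unfold Rdiv. rewrite Rmult_plus_distr_r.
  assert (Hqi : 0 <= 2 * Cmod s * (2 * (1 + Rabs u)) * / m) by nra.
  (* When [k + u >= m / 2], adding [v ^ 2 / m] to [k + u] raises its square by at least [v ^ 2].
     Otherwise [m < 2 (1 + Rabs u)], and the second part of [B] absorbs the crude excess
     [2 Cmod s]. *)
  destruct (Rle_dec (m / 2) (INR k + u)) as [h|h].
  - set (w := v ^ 2 * / m).
    assert (Hw : 0 <= w) by (unfold w; nra).
    apply Rle_trans with (INR k + u + w); [|lra].
    assert (Hsq : Cmod (s + RtoC (INR k)) ^ 2 <= (INR k + u + w) ^ 2).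
    { rewrite Cmod2_alt.
      replace (Re (s + RtoC (INR k))) with (INR k + u)
        by (unfold u, Re; simpl; ring).
      replace (Im (s + RtoC (INR k))) with v by (unfold v, Im; simpl; ring).
      assert (v ^ 2 <= 2 * (INR k + u) * w).
      { replace (v ^ 2) with (m * w) by (unfold w; field; lra).
        apply Rmult_le_compat_r; lra. }
      nra. }
    apply Rsqr_incr_0; [unfold Rsqr; nra|apply Cmod_ge_0|lra].
  - assert (Hlt : m < 2 * (1 + Rabs u)).
    { generalize (Rle_abs (- u)). rewrite Rabs_Ropp. unfold m in *. lra. }
    assert (H1 : Cmod (s + RtoC (INR k)) <= INR k + u + 2 * Cmod s).
    { eapply Rle_trans; [apply Cmod_triangle|].
      rewrite Cmod_R, Rabs_pos_eq by auto.
      generalize (Rle_abs (- u)). rewrite Rabs_Ropp. lra. }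
    assert (H2 : 2 * Cmod s <= 2 * Cmod s * (2 * (1 + Rabs u)) * / m).
    { apply Rmult_le_reg_r with m; [lra|].
      replace (2 * Cmod s * (2 * (1 + Rabs u)) * / m * m)
        with (2 * Cmod s * (2 * (1 + Rabs u))) by (field; lra).
      apply Rmult_le_compat_l; lra. }
    assert (0 <= v ^ 2 * / m) by nra. lra.
Qed.

(** Compares one step of the residues with one step of [(k + 1) ^ 3 * decay e k], where [m = k + 1].
    Both are [1 + (3 - e) / m] to first order; the [+ 2] pays for the cross term [3 e / m ^ 2], as
    [e <= 1 / 2]. *)
Lemma ratio_growth_bound (e B m t : R) : 0 < e <= 1 / 2 -> 0 <= B -> 1 <= m ->
  t <= m + (3 - e) + B / m ->
  t / m <= (1 + (B + 2) / m ^ 2) * (((m + 1) / m) ^ 3 * (1 - e / m)).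
Proof.
  intros He HB Hm Ht.
  set (y := / m). assert (Hy : 0 < y) by (apply Rinv_0_lt_compat; lra).
  assert (Hy1 : y <= 1) by (unfold y; rewrite <- Rinv_1;
    apply Rinv_le_contravar; lra).
  replace ((m + 1) / m) with (1 + y) by (unfold y; field; lra).
  replace (e / m) with (e * y) by reflexivity.
  replace ((B + 2) / m ^ 2) with ((B + 2) * y ^ 2) by (unfold y; field; lra).
  apply Rle_trans with (1 + (3 - e) * y + B * y ^ 2).
  { replace (1 + (3 - e) * y + B * y ^ 2) with ((m + (3 - e) + B / m) / m)
      by (unfold y; field; lra).
    apply Rmult_le_compat_r; [fold y; lra|auto]. }
  set (r := 1 + (3 - e) * y - 3 * e * y ^ 2).
  assert (Hr : 1 <= r) by (unfold r; nra).
  assert (Hrho : r <= (1 + y) ^ 3 * (1 - e * y)).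
  { replace r with ((1 + 3 * y) * (1 - e * y)) by (unfold r; ring).
    apply Rmult_le_compat_r; [nra|].
    assert (0 <= y ^ 2) by nra. assert (0 <= y ^ 3) by (apply pow_le; lra). nra. }
  assert (Hb : 0 <= (B + 2) * y ^ 2) by (apply Rmult_le_pos; [lra|nra]).
  apply Rle_trans with ((1 + (B + 2) * y ^ 2) * r).
  - apply Rle_trans with (r + (B + 2) * y ^ 2); [|nra].
    unfold r. assert (0 <= y ^ 2) by nra. nra.
  - apply Rmult_le_compat_l; lra.
Qed.

(** The cutoff [(n - k) / d] is about [1 - 2 k / n], while [1 + k ^ 2 / n] grows by a factor of at
    most [1 + (2 k + 1) / n]. They cancel up to [O(1 / n)], which over [n] steps costs only a
    bounded factor. *)
Lemma gaussian_factor_bound (n k S d : R) :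
  0 <= S -> 1 <= n -> 2 * S <= n -> 0 <= k <= n -> n + k - S <= d ->
  (n - k) * (1 + (k + 1) ^ 2 / n) <= (1 + 2 * (S + 1) / n) * (1 + k ^ 2 / n) * d.
Proof.
  intros HS Hn Hn2 Hk Hd.
  assert (Hi : 0 < / n) by (apply Rinv_0_lt_compat; lra).
  assert (Hk2 : 0 <= k ^ 2 / n) by (apply Rmult_le_pos; [nra|lra]).
  assert (Hk3 : 0 <= (2 * k + 1) / n) by (apply Rmult_le_pos; lra).
  apply Rle_trans with ((n - k) * ((1 + k ^ 2 / n) * (1 + (2 * k + 1) / n))).
  { apply Rmult_le_compat_l; [lra|].
    replace ((k + 1) ^ 2 / n) with (k ^ 2 / n + (2 * k + 1) / n) by (field; lra).
    nra. }
  replace ((n - k) * ((1 + k ^ 2 / n) * (1 + (2 * k + 1) / n)))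
    with ((1 + k ^ 2 / n) * (/ n * ((n - k) * (n + 2 * k + 1)))) by (field; lra).
  replace ((1 + 2 * (S + 1) / n) * (1 + k ^ 2 / n) * d)
    with ((1 + k ^ 2 / n) * (/ n * ((n + 2 * (S + 1)) * d))) by (field; lra).
  apply Rmult_le_compat_l; [lra|]. apply Rmult_le_compat_l; [lra|].
  apply Rle_trans with ((n + 2 * (S + 1)) * (n + k - S));
    [|apply Rmult_le_compat_l; lra].
  nra.
Qed.

(* [residue_seq s n k] behaves like [k ^ (s - 1) exp (- k ^ 2 / n)]; the factor
   [1 + k ^ 2 / n] keeps as much of the Gaussian as the next step consumes. *)
Lemma residue_seq_bound (s : C) : ~ nonpos_integer s -> Re s < 4 ->
  exists e M N, 0 < e <= 1 / 2 /\ 0 <= M /\ (1 <= N)%nat /\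
  forall n k, (N <= n)%nat -> (k <= n)%nat ->
    Cmod (residue_seq s n k) * (1 + INR k ^ 2 / INR n)
    <= M * ((INR k + 1) ^ 3 * decay e k).
Proof.
  intros Hs H4.
  set (e := Rmin (4 - Re s) (1 / 2)).
  assert (He : 0 < e <= 1 / 2).
  { unfold e. split; [apply Rmin_pos; lra|apply Rmin_r]. }
  assert (He4 : e <= 4 - Re s) by apply Rmin_l.
  destruct (Cmod_plus_nat_upper s) as [B [HB HBk]].
  set (G := Rabs (Re s)).
  assert (HG : 0 <= G) by apply Rabs_pos.
  assert (HGs : - G <= Re s).
  { unfold G. generalize (Rle_abs (- Re s)). rewrite Rabs_Ropp. lra. }
  (* [Cn / n] is the loss per step in the Gaussian factor. [B2] absorbs the cross term when
     [1 + Cn / n] is multiplied by [1 + (B + 2) / m ^ 2]. *)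
  set (Cn := 2 * (G + 1)). set (B2 := (B + 2) * (1 + Cn)).
  assert (HCn : 0 <= Cn) by (unfold Cn; lra).
  assert (HB2 : 0 <= B2) by (unfold B2; apply Rmult_le_pos; lra).
  assert (HGam := is_Clim_Cmod _ _ (is_Clim_Gamma_seq s Hs)).
  apply is_lim_seq_spec in HGam.
  destruct (HGam (mkposreal 1 Rlt_0_1)) as [N1 HN1]. simpl in HN1.
  destruct (INR_unbounded (2 * G)) as [N2 HN2].
  (* The starting value at [k = 0] is [Gamma_seq s n], within 1 of its limit in modulus from [N1]
     on; the exponential bounds all later growth. [N2] secures [2 * G <= n]. *)
  exists e, ((Cmod (CGamma s) + 1) * exp (Cn + 2 * B2)), (1 + N1 + N2)%nat.
  split; [auto|]. split.
  { apply Rmult_le_pos; [generalize (Cmod_ge_0 (CGamma s)); lra|].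
    left. apply exp_pos. }
  split; [lia|].
  intros n k Hn Hk.
  assert (Hn1 : 1 <= INR n) by (apply (le_INR 1); lia).
  assert (Hn2 : 2 * G <= INR n).
  { assert (N2 <= n)%nat as h by lia. apply le_INR in h. lra. }
  assert (Hg : Cmod (Gamma_seq s n) <= Cmod (CGamma s) + 1).
  { specialize (HN1 n ltac:(lia)). apply Rabs_def2 in HN1. lra. }
  set (x := fun k => Cmod (residue_seq s n k) * (1 + INR k ^ 2 / INR n)
                     / ((INR k + 1) ^ 3 * decay e k)).
  (* Its increments dominate both losses, [Cn / n] and [B2 / m ^ 2], yet its total rise for [k <= n]
     is at most [Cn + 2 * B2], whatever [n] is. *)
  set (D := fun k => Cn * INR k / INR n - 2 * B2 / (INR k + 1)).
  assert (Hin : 0 < / INR n) by (apply Rinv_0_lt_compat; lra).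
  assert (Hden : forall k, 0 < (INR k + 1) ^ 3 * decay e k).
  { intros j. apply Rmult_lt_0_compat; [|now apply decay_pos].
    apply pow_lt. generalize (pos_INR j). lra. }
  assert (Hq : forall k, 0 <= INR k ^ 2 / INR n).
  { intros j. apply Rmult_le_pos; [apply pow_le, pos_INR|lra]. }
  assert (Hx : x k <= x O * exp (D k - D O)).
  { apply product_bound with n; auto.
    - intros j. unfold x. apply Rmult_le_pos.
      + apply Rmult_le_pos; [apply Cmod_ge_0|]. generalize (Hq j). lra.
      + left. apply Rinv_0_lt_compat, Hden.
    - intros j Hj. unfold x. rewrite residue_seq_S by auto.
      assert (Hj0 := pos_INR j). assert (HjR := lt_INR _ _ Hj).
      set (m := INR j + 1).
      assert (Hm : 1 <= m) by (unfold m; lra).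
      assert (Hrho := ratio_growth_bound e B m (Cmod (s + RtoC (INR j))) He HB Hm).
      assert (Hne := not_nonpos_integer_neq_0 s (j + S n) Hs).
      rewrite plus_INR, RtoC_plus, RtoC_S, !Cplus_assoc in Hne.
      set (d := Cmod (s + RtoC (INR j) + RtoC (INR n) + 1)).
      assert (Hd : INR n + INR j - G <= d).
      { unfold d. eapply Rle_trans; [|apply re_le_Cmod].
        eapply Rle_trans; [|apply Rle_abs].
        unfold Re, RtoC in *; simpl. lra. }
      assert (Hd0 : 0 < d) by now apply Cmod_gt_0.
      assert (Hgau := gaussian_factor_bound (INR n) (INR j) G d HG Hn1 Hn2
        ltac:(lra) Hd).
      fold Cn in Hgau.
      rewrite !Cmod_mult, Cmod_div, !Cmod_mult.
      2:{ apply Cmult_neq_0; [apply RtoC_S_neq_0|auto]. }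
      fold d. rewrite <- RtoC_minus, <- RtoC_plus, !Cmod_R, !Rabs_pos_eq by lra.
      simpl decay. rewrite (S_INR j). fold m.
      set (U := Cmod (residue_seq s n j)).
      assert (HU : 0 <= U) by apply Cmod_ge_0.
      assert (HE := decay_pos e j He). assert (HES := decay_pos e (S j) He).
      simpl in HES. fold m in HES. set (E := decay e j) in *.
      assert (Hem : 0 < 1 - e / m).
      { apply Rmult_lt_reg_l with E; auto. lra. }
      set (t := Cmod (s + RtoC (INR j))) in *.
      assert (Ht0 : 0 <= t) by apply Cmod_ge_0.
      assert (Ht : t <= m + (3 - e) + B / m).
      { eapply Rle_trans; [apply HBk|]. unfold m. lra. }
      specialize (Hrho Ht).
      set (g := (INR n - INR j) * (1 + m ^ 2 / INR n) / d).
      assert (Hg1 : g <= (1 + Cn / INR n) * (1 + INR j ^ 2 / INR n)).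
      { unfold g. apply Rmult_le_reg_r with d; auto.
        unfold Rdiv at 1. rewrite Rmult_assoc, Rinv_l, Rmult_1_r by lra.
        exact Hgau. }
      assert (Hg0 : 0 <= g).
      { unfold g. apply Rmult_le_pos; [|left; now apply Rinv_0_lt_compat].
        apply Rmult_le_pos; [lra|].
        assert (0 <= m ^ 2 / INR n) by (apply Rmult_le_pos; [nra|lra]). lra. }
      set (rho := ((m + 1) / m) ^ 3 * (1 - e / m)) in *.
      assert (Hr0 : 0 < rho).
      { unfold rho. apply Rmult_lt_0_compat; auto.
        apply pow_lt. apply Rdiv_lt_0_compat; lra. }
      (* The step factor splits into the Gaussian part [g] and the growth part [t / m / rho], each
         controlled by its own lemma. *)
      replace (U * ((INR n - INR j) * t / (m * d)) * (1 + m ^ 2 / INR n)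
               / ((m + 1) ^ 3 * (E * (1 - e / m))))
        with (U / (m ^ 3 * E) * (g * (t / m / rho)))
        by (unfold g, rho; field; repeat split; lra).
      replace (U * (1 + INR j ^ 2 / INR n) / (m ^ 3 * E)
               * (1 + (D (S j) - D j)))
        with (U / (m ^ 3 * E)
              * ((1 + INR j ^ 2 / INR n) * (1 + (D (S j) - D j))))
        by (field; repeat split; lra).
      apply Rmult_le_compat_l.
      { apply Rmult_le_pos; auto. left. apply Rinv_0_lt_compat.
        apply Rmult_lt_0_compat; auto. apply pow_lt. lra. }
      assert (Htr : t / m / rho <= 1 + (B + 2) / m ^ 2).
      { apply Rmult_le_reg_r with rho; auto.
        unfold Rdiv at 1. rewrite Rmult_assoc, Rinv_l, Rmult_1_r by lra.
        exact Hrho. }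
      assert (Htr0 : 0 <= t / m / rho).
      { apply Rmult_le_pos; [apply Rmult_le_pos; auto|];
          left; apply Rinv_0_lt_compat; lra. }
      apply Rle_trans with ((1 + Cn / INR n) * (1 + INR j ^ 2 / INR n)
                            * (1 + (B + 2) / m ^ 2)).
      { now apply Rmult_le_compat. }
      replace ((1 + Cn / INR n) * (1 + INR j ^ 2 / INR n) * (1 + (B + 2) / m ^ 2))
        with ((1 + INR j ^ 2 / INR n)
              * ((1 + Cn / INR n) * (1 + (B + 2) / m ^ 2))) by ring.
      apply Rmult_le_compat_l; [generalize (Hq j); lra|].
      assert (Htel := inv_square_telescope B2 m HB2 Hm).
      replace (D (S j) - D j)
        with (Cn / INR n + (2 * B2 / m - 2 * B2 / (m + 1))).
      2:{ unfold D. rewrite (S_INR j). fold m.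
          replace (INR j) with (m - 1) by (unfold m; ring).
          field. repeat split; lra. }
      assert (Hcn : 0 <= Cn / INR n <= Cn).
      { split; [apply Rmult_le_pos; lra|].
        rewrite <- (Rmult_1_r Cn) at 2. apply Rmult_le_compat_l; auto.
        rewrite <- Rinv_1. apply Rinv_le_contravar; lra. }
      assert (Hbm : 0 <= (B + 2) / m ^ 2).
      { apply Rmult_le_pos; [lra|]. left. apply Rinv_0_lt_compat. nra. }
      assert (HB2m : B2 / m ^ 2 = (B + 2) / m ^ 2 * (1 + Cn))
        by (unfold B2, Rdiv; ring).
      rewrite HB2m in Htel. nra. }
  assert (Hx0 : x O = Cmod (Gamma_seq s n)).
  { unfold x. rewrite residue_seq_0 by auto. simpl. field. lra. }
  assert (HD : D k - D O <= Cn + 2 * B2).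
  { unfold D. simpl (INR 0). assert (Hk0 := pos_INR k).
    assert (0 <= 2 * B2 / (INR k + 1)).
    { apply Rmult_le_pos; [lra|]. left. apply Rinv_0_lt_compat. lra. }
    assert (Cn * INR k / INR n <= Cn).
    { apply Rmult_le_reg_r with (INR n); [lra|].
      unfold Rdiv. rewrite Rmult_assoc, Rinv_l, Rmult_1_r by lra.
      apply Rmult_le_compat_l; auto. now apply le_INR. }
    replace (Cn * 0 / INR n) with 0 by (field; lra).
    replace (2 * B2 / (0 + 1)) with (2 * B2) by field. lra. }
  assert (Hfin : x k <= (Cmod (CGamma s) + 1) * exp (Cn + 2 * B2)).
  { eapply Rle_trans; [exact Hx|]. rewrite Hx0.
    apply Rmult_le_compat; auto.
    - apply Cmod_ge_0.
    - left. apply exp_pos.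
    - now apply exp_le_exp. }
  replace (Cmod (residue_seq s n k) * (1 + INR k ^ 2 / INR n))
    with (x k * ((INR k + 1) ^ 3 * decay e k)).
  - apply Rmult_le_compat_r; auto. left. apply Hden.
  - unfold x. field. specialize (Hden k). split; [lra|].
    split; intro E0; rewrite E0 in Hden; [|]; ring_simplify in Hden; lra.
Qed.

Lemma Cmod_inv_plus_nat_bound (w : C) : ~ nonpos_integer w ->
  exists c, 0 < c /\ forall k,
    Cmod (/ (w + RtoC (INR k))) <= c / (INR k + 1) /\
    Cmod (/ (w + RtoC (INR (S k)))) <= c / (INR k + 1) /\
    Cmod (/ (w + RtoC (INR k)) - / (w + RtoC (INR (S k))))
      <= (c / (INR k + 1)) ^ 2.
Proof.
  intros Hw. destruct (Cmod_plus_nat_lower w Hw) as [c [Hc Hl]].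
  exists (/ c). split; [now apply Rinv_0_lt_compat|]. intros k.
  assert (Hk := pos_INR k).
  assert (Hb : forall j, (k <= j)%nat ->
    Cmod (/ (w + RtoC (INR j))) <= / c / (INR k + 1)).
  { intros j Hj. rewrite Cmod_inv by now apply not_nonpos_integer_neq_0.
    replace (/ c / (INR k + 1)) with (/ (c * (INR k + 1))) by (field; lra).
    apply Rinv_le_contravar; [nra|].
    eapply Rle_trans; [|apply Hl]. apply le_INR in Hj.
    apply Rmult_le_compat_l; lra. }
  assert (H1 := Hb k ltac:(lia)). assert (H2 := Hb (S k) ltac:(lia)).
  repeat split; auto.
  assert (N1 := not_nonpos_integer_neq_0 w k Hw).
  assert (N2 := not_nonpos_integer_neq_0 w (S k) Hw).
  replace (/ (w + RtoC (INR k)) - / (w + RtoC (INR (S k))))%C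
    with (/ (w + RtoC (INR k)) * / (w + RtoC (INR (S k))))%C.
  - rewrite Cmod_mult. simpl. rewrite Rmult_1_r.
    apply Rmult_le_compat; auto; apply Cmod_ge_0.
  - rewrite RtoC_S in *. field. auto.
Qed.

(** By the product rule for differences, each increment of an inverse linear factor gains one power
    of [k + 1]. *)
Lemma weight_bound (a z : C) :
  ~ nonpos_integer a -> ~ nonpos_integer (a + z) -> ~ nonpos_integer (a - z) ->
  exists W, 0 <= W /\ forall k,
    Cmod (weight a z k) <= W / (INR k + 1) ^ 3 /\
    Cmod (weight a z (S k)) <= W / (INR k + 1) ^ 3 /\
    Cmod (weight a z k - weight a z (S k)) <= W / (INR k + 1) ^ 4.
Proof.
  intros Ha Hp Hm.
  destruct (Cmod_inv_plus_nat_bound a Ha) as [c1 [Hc1 H1]].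
  destruct (Cmod_inv_plus_nat_bound _ Hp) as [c2 [Hc2 H2]].
  destruct (Cmod_inv_plus_nat_bound _ Hm) as [c3 [Hc3 H3]].
  assert (Hc : 0 < c1 * c2 * c3) by (repeat apply Rmult_lt_0_compat; auto).
  exists (c1 * c2 * c3 * (1 + (c1 + c2 + c3))).
  split; [apply Rmult_le_pos; lra|]. intros k.
  assert (Hw : forall j, weight a z j = (/ (a + RtoC (INR j))
     * / (a + z + RtoC (INR j)) * / (a - z + RtoC (INR j)))%C).
  { intros j. unfold weight. field.
    repeat split; now apply not_nonpos_integer_neq_0. }
  rewrite !Hw.
  destruct (H1 k) as [p [p' dp]]. destruct (H2 k) as [q [q' dq]].
  destruct (H3 k) as [r [r' dr]]. clear H1 H2 H3.
  set (A := (/ (a + RtoC (INR k)))%C) in *.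
  set (A' := (/ (a + RtoC (INR (S k))))%C) in *.
  set (B := (/ (a + z + RtoC (INR k)))%C) in *.
  set (B' := (/ (a + z + RtoC (INR (S k))))%C) in *.
  set (D := (/ (a - z + RtoC (INR k)))%C) in *.
  set (D' := (/ (a - z + RtoC (INR (S k))))%C) in *.
  set (m := INR k + 1) in *.
  assert (Hm1 : 1 <= m) by (unfold m; generalize (pos_INR k); lra).
  assert (Hpr : forall x y z x' y' z', Cmod x <= x' -> Cmod y <= y' ->
    Cmod z <= z' -> Cmod (x * y * z) <= x' * y' * z').
  { intros x y v x' y' v' hx hy hv. rewrite !Cmod_mult.
    repeat apply Rmult_le_compat; auto; try apply Cmod_ge_0.
    apply Rmult_le_pos; apply Cmod_ge_0. }
  assert (Hle : c1 / m * (c2 / m) * (c3 / m)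
            <= c1 * c2 * c3 * (1 + (c1 + c2 + c3)) / m ^ 3).
  { replace (c1 / m * (c2 / m) * (c3 / m)) with (c1 * c2 * c3 * / m ^ 3)
      by (field; lra).
    apply Rmult_le_compat_r; [left; apply Rinv_0_lt_compat, pow_lt; lra|]. nra. }
  repeat split.
  - eapply Rle_trans; [apply Hpr; eauto|exact Hle].
  - eapply Rle_trans; [apply Hpr; eauto|exact Hle].
  - replace (A * B * D - A' * B' * D')%C
      with ((A - A') * B * D + (A' * (B - B') * D + A' * B' * (D - D')))%C
      by ring.
    eapply Rle_trans; [apply Cmod_triangle|].
    eapply Rle_trans; [apply Rplus_le_compat_l, Cmod_triangle|].
    apply Rle_trans with ((c1 / m) ^ 2 * (c2 / m) * (c3 / m)
      + (c1 / m * (c2 / m) ^ 2 * (c3 / m) + c1 / m * (c2 / m) * (c3 / m) ^ 2)).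
    { apply Rplus_le_compat; [apply Hpr; auto|].
      apply Rplus_le_compat; apply Hpr; auto. }
    replace ((c1 / m) ^ 2 * (c2 / m) * (c3 / m)
      + (c1 / m * (c2 / m) ^ 2 * (c3 / m) + c1 / m * (c2 / m) * (c3 / m) ^ 2))
      with (c1 * c2 * c3 * (c1 + c2 + c3) * / m ^ 4) by (field; lra).
    apply Rmult_le_compat_r; [left; apply Rinv_0_lt_compat, pow_lt; lra|]. nra.
Qed.

(** In 1 minus the ratio the products [n k] cancel, leaving a numerator [O(n + (k + 1) ^ 2)] over a
    denominator of size at least a multiple of [(k + 1) n]. The square is the price of the Gaussian
    cutoff. *)
Lemma residue_seq_diff_bound (s : C) : ~ nonpos_integer s ->
  exists Q, 0 <= Q /\ forall n k, (k < n)%nat ->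
    Cmod (residue_seq s n k - residue_seq s n (S k))
    <= Cmod (residue_seq s n k)
       * (Q * (1 + (INR k + 1) ^ 2 / INR n) / (INR k + 1)).
Proof.
  intros Hs. destruct (Cmod_plus_nat_lower s Hs) as [c [Hc Hl]].
  assert (Hs0 := Cmod_ge_0 s).
  exists (3 * (Cmod s + 1) / c).
  split; [apply Rmult_le_pos; [lra|left; now apply Rinv_0_lt_compat]|].
  intros n k Hk. rewrite residue_seq_S by auto.
  assert (Hk0 := pos_INR k). assert (HkR := lt_INR _ _ Hk).
  assert (Hne := not_nonpos_integer_neq_0 s (k + S n) Hs).
  assert (Hlow := Hl (k + S n)%nat).
  rewrite plus_INR, RtoC_plus, RtoC_S, !Cplus_assoc in Hne, Hlow.
  rewrite S_INR in Hlow.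
  assert (N := RtoC_S_neq_0 k).
  set (u := residue_seq s n k).
  set (num := ((RtoC (INR k) + 1 + RtoC (INR k)) * (s + RtoC (INR k))
               + (RtoC (INR k) + 1) + RtoC (INR n) * (1 - s))%C).
  set (den := ((RtoC (INR k) + 1) * (s + RtoC (INR k) + RtoC (INR n) + 1))%C).
  assert (Nd : den <> RtoC 0) by now apply Cmult_neq_0.
  replace (u - u * ((RtoC (INR n) - RtoC (INR k)) * (s + RtoC (INR k)) / den))%C
    with (u * (num / den))%C.
  2:{ unfold num. transitivity (u * (den
        - (RtoC (INR n) - RtoC (INR k)) * (s + RtoC (INR k))) / den)%C.
      - unfold Cdiv. rewrite !Cmult_assoc. f_equal. f_equal. unfold den. ring.
      - field. auto. }
  rewrite Cmod_mult. apply Rmult_le_compat_l; [apply Cmod_ge_0|].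
  rewrite Cmod_div by auto.
  set (m := INR k + 1) in *.
  assert (Hm1 : 1 <= m) by (unfold m; lra).
  assert (Hnum : Cmod num <= 3 * (Cmod s + 1) * (INR n + m ^ 2)).
  { unfold num.
    eapply Rle_trans; [apply Cmod_triangle|].
    eapply Rle_trans; [apply Rplus_le_compat_r, Cmod_triangle|].
    rewrite !Cmod_mult, <- !RtoC_plus, !Cmod_R, !Rabs_pos_eq by lra.
    assert (Ha : Cmod (s + RtoC (INR k)) <= (Cmod s + 1) * m).
    { eapply Rle_trans; [apply Cmod_triangle|].
      rewrite Cmod_R, Rabs_pos_eq by auto. unfold m. nra. }
    assert (Hb : Cmod (1 - s) <= 1 + Cmod s).
    { eapply Rle_trans; [apply Cmod_triangle|]. rewrite Cmod_opp, Cmod_1. lra. }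
    assert (H1 : (INR k + 1 + INR k) * Cmod (s + RtoC (INR k))
              <= 2 * m * ((Cmod s + 1) * m)).
    { apply Rmult_le_compat; auto; try apply Cmod_ge_0; unfold m; lra. }
    assert (H2 : INR n * Cmod (1 - s) <= INR n * (1 + Cmod s))
      by (apply Rmult_le_compat_l; lra).
    fold m in H1 |- *. assert (H3 : m <= (Cmod s + 1) * m ^ 2) by nra.
    assert (0 <= INR n * (1 + Cmod s)) by nra. lra. }
  assert (Hden : c * m * INR n <= Cmod den).
  { unfold den. rewrite Cmod_mult, <- RtoC_plus, Cmod_R, Rabs_pos_eq by lra.
    fold m. apply Rle_trans with (m * (c * INR n)); [right; ring|].
    apply Rmult_le_compat_l; [lra|].
    eapply Rle_trans; [|exact Hlow]. apply Rmult_le_compat_l; lra. }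
  assert (Hcm : 0 < c * m * INR n) by (repeat apply Rmult_lt_0_compat; lra).
  replace (3 * (Cmod s + 1) / c * (1 + m ^ 2 / INR n) / m)
    with (3 * (Cmod s + 1) * (INR n + m ^ 2) * / (c * m * INR n))
    by (field; repeat split; lra).
  apply Rmult_le_compat; auto.
  - apply Cmod_ge_0.
  - left. apply Rinv_0_lt_compat. lra.
  - now apply Rinv_le_contravar.
Qed.

Lemma truncated_term_bound (a z : C) :
  ~ nonpos_integer a -> ~ nonpos_integer (a + z) -> ~ nonpos_integer (a - z) ->
  ~ nonpos_integer (2 * a) -> Re a < 2 ->
  exists (F : nat -> R) (N : nat), is_lim_seq F 0 /\
    (forall n k, (N <= n)%nat -> (k <= n)%nat ->
       Cmod (residue_seq (2 * a) n k * weight a z k) <= F k) /\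
    (forall n k, (N <= n)%nat -> (k < n)%nat ->
       Cmod (residue_seq (2 * a) n k * weight a z k
             - residue_seq (2 * a) n (S k) * weight a z (S k))
       <= F k - F (S k)).
Proof.
  intros Ha Hp Hm H2 Hre.
  destruct (residue_seq_bound (2 * a) H2) as [e [M [N [He [HM [HN Hb]]]]]].
  { unfold Re in *; simpl. lra. }
  destruct (weight_bound a z Ha Hp Hm) as [W [HW Hw]].
  destruct (residue_seq_diff_bound (2 * a) H2) as [Q [HQ Hq]].
  (* The first summand bounds the terms, the second their differences; the division by [e] offsets
     the factor [e] in [decay_diff]. *)
  set (A := M * W + M * (4 * W * (1 + Q)) / e).
  assert (HA0 : 0 <= M * (4 * W * (1 + Q)) / e).
  { apply Rmult_le_pos; [|left; apply Rinv_0_lt_compat; lra].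
    repeat apply Rmult_le_pos; lra. }
  assert (HMW : 0 <= M * W) by now apply Rmult_le_pos.
  exists (fun k => A * decay e k), N. repeat split.
  - replace 0 with (A * 0) by ring.
    apply (is_lim_seq_scal_l _ A 0). now apply is_lim_seq_decay.
  - intros n k Hn Hk. specialize (Hb n k Hn Hk).
    destruct (Hw k) as [Hw0 _].
    assert (Hn1 : 1 <= INR n) by (apply (le_INR 1); lia).
    assert (Hk0 := pos_INR k). assert (HE := decay_pos e k He).
    set (m := INR k + 1) in *. assert (Hm1 : 1 <= m) by (unfold m; lra).
    assert (Hu : Cmod (residue_seq (2 * a) n k) <= M * (m ^ 3 * decay e k)).
    { eapply Rle_trans; [|exact Hb].
      rewrite <- (Rmult_1_r (Cmod _)) at 1.
      apply Rmult_le_compat_l; [apply Cmod_ge_0|].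
      assert (0 <= INR k ^ 2 / INR n)
        by (apply Rmult_le_pos; [nra|left; apply Rinv_0_lt_compat; lra]). lra. }
    rewrite Cmod_mult.
    apply Rle_trans with (M * (m ^ 3 * decay e k) * (W / m ^ 3)).
    + apply Rmult_le_compat; auto; apply Cmod_ge_0.
    + replace (M * (m ^ 3 * decay e k) * (W / m ^ 3))
        with (M * W * decay e k) by (field; lra).
      apply Rmult_le_compat_r; [lra|]. unfold A. lra.
  - intros n k Hn Hk. specialize (Hb n k Hn ltac:(lia)).
    destruct (Hw k) as [_ [Hw1 Hwd]]. specialize (Hq n k Hk).
    assert (Hn1 : 1 <= INR n) by (apply (le_INR 1); lia).
    assert (Hin : 0 < / INR n) by (apply Rinv_0_lt_compat; lra).
    assert (Hk0 := pos_INR k). assert (HE := decay_pos e k He).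
    assert (Hdd := decay_diff e k).
    set (m := INR k + 1) in *. assert (Hm1 : 1 <= m) by (unfold m; lra).
    set (u := residue_seq (2 * a) n k) in *.
    set (u' := residue_seq (2 * a) n (S k)) in *.
    set (h := weight a z k) in *. set (h' := weight a z (S k)) in *.
    assert (HU := Cmod_ge_0 u). set (U := Cmod u) in *.
    assert (Hm4 : 0 < / m ^ 4) by (apply Rinv_0_lt_compat, pow_lt; lra).
    set (P := 1 + m ^ 2 / INR n) in *.
    assert (HP1 : 1 <= P).
    { assert (0 <= m ^ 2 / INR n) by (apply Rmult_le_pos; [nra|lra]).
      unfold P. lra. }
    (* The shift from [k + 1] to [k] costs a factor 4, after which the weight is the one that
       [residue_seq_bound] absorbs. *)
    assert (HP : P <= 4 * (1 + INR k ^ 2 / INR n)).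
    { unfold P, m. apply Rmult_le_reg_r with (INR n); [lra|].
      replace ((1 + (INR k + 1) ^ 2 / INR n) * INR n)
        with (INR n + (INR k + 1) ^ 2) by (field; lra).
      replace (4 * (1 + INR k ^ 2 / INR n) * INR n)
        with (4 * (INR n + INR k ^ 2)) by (field; lra). nra. }
    replace (u * h - u' * h')%C with (u * (h - h') + (u - u') * h')%C by ring.
    eapply Rle_trans; [apply Cmod_triangle|]. rewrite !Cmod_mult. fold U.
    apply Rle_trans with (U * (W / m ^ 4) + U * (Q * P / m) * (W / m ^ 3)).
    { apply Rplus_le_compat.
      - apply Rmult_le_compat_l; auto.
      - apply Rmult_le_compat; auto; apply Cmod_ge_0. }
    replace (U * (W / m ^ 4) + U * (Q * P / m) * (W / m ^ 3))
      with (U * W * / m ^ 4 * (1 + Q * P)) by (field; lra).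
    assert (HUW : 0 <= U * W * / m ^ 4)
      by (repeat apply Rmult_le_pos; auto; lra).
    apply Rle_trans with (U * W * / m ^ 4
      * ((1 + Q) * (4 * (1 + INR k ^ 2 / INR n)))).
    { apply Rmult_le_compat_l; auto.
      apply Rle_trans with ((1 + Q) * P); [nra|].
      apply Rmult_le_compat_l; lra. }
    replace (U * W * / m ^ 4 * ((1 + Q) * (4 * (1 + INR k ^ 2 / INR n))))
      with (U * (1 + INR k ^ 2 / INR n) * (4 * W * (1 + Q) * / m ^ 4)) by ring.
    apply Rle_trans with (M * (m ^ 3 * decay e k) * (4 * W * (1 + Q) * / m ^ 4)).
    { apply Rmult_le_compat_r; auto. repeat apply Rmult_le_pos; lra. }
    replace (A * decay e k - A * decay e (S k))
      with (A * (decay e k - decay e (S k))) by ring.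
    rewrite Hdd.
    replace (M * (m ^ 3 * decay e k) * (4 * W * (1 + Q) * / m ^ 4))
      with (M * (4 * W * (1 + Q)) / e * (e * (decay e k / m)))
      by (field; lra).
    apply Rmult_le_compat_r.
    + apply Rmult_le_pos; [lra|]. apply Rmult_le_pos; [lra|].
      left. apply Rinv_0_lt_compat. lra.
    + unfold A. lra.
Qed.

(** * Passage to the limit in the truncated identity *)

Theorem theorem2 (a z : C)
  (ha : ~ nonpos_integer a)
  (haz : ~ nonpos_integer (a + z)%C)
  (haz' : ~ nonpos_integer (a - z)%C)
  (h2a : ~ nonpos_integer (RtoC 2 * a)%C)
  (hconv : (Re a < 2)%R \/ z = RtoC 0) :
  exists S : C,
    is_series (fun k : nat =>
      (RtoC (-1) ^ (k + 1) * CGamma (RtoC 2 * a + RtoC (INR k))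
         / ((a + RtoC (INR k)) * RtoC (INR (fact k)))
       * (RtoC 2 * z ^ 2 / (z ^ 2 - (a + RtoC (INR k)) ^ 2)))%C) S
    /\ (CGamma (a + z) * CGamma (a - z))%C = (CGamma a ^ 2 + S)%C.
Proof.
  set (T := fun k => (CGamma (2 * a + RtoC (INR k)) / RtoC (INR (fact k))
                      * weight a z k)%C).
  exists (CGamma (a + z) * CGamma (a - z) - CGamma a * CGamma a)%C.
  split; [|simpl; ring].
  apply is_Clim_is_series.
  apply (is_Clim_ext_loc (fun n => 2 * z ^ 2
           * Csum (fun k => (-(1)) ^ k * T k) n)%C).
  { exists 0%nat. intros n _. rewrite <- Csum_scal. apply Csum_ext.
    intros k _. unfold T, weight.
    assert (N1 := not_nonpos_integer_neq_0 _ k ha).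
    assert (N2 := not_nonpos_integer_neq_0 _ k haz).
    assert (N3 := not_nonpos_integer_neq_0 _ k haz').
    assert (N4 := RtoC_fact_neq_0 k).
    rewrite Nat.add_1_r, (Cpow_S _ k).
    replace (RtoC (-1)) with (-(1))%C
      by (rewrite <- RtoC_opp; reflexivity).
    (* Reversing this denominator supplies the sign that turns [(-1) ^ (k + 1)] into [(-1) ^ k]. *)
    replace (z ^ 2 - (a + RtoC (INR k)) ^ 2)%C
      with (- ((a + z + RtoC (INR k)) * (a - z + RtoC (INR k))))%C by ring.
    field. repeat split; auto. }
  destruct hconv as [hre | ->].
  - destruct (truncated_term_bound a z ha haz haz' h2a hre)
      as [F [N [HF [Hb Hd]]]].
    assert (HT : is_Clim (fun n => Csum (fun k => (-(1)) ^ k * T k) n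
        - Csum (fun k => (-(1)) ^ k
                 * (residue_seq (2 * a) n k * weight a z k)) n)%C 0).
    { apply alternating_tannery with F N; auto.
      intros k. apply is_Clim_mult; [|apply is_Clim_const].
      now apply is_Clim_residue_seq. }
    apply (is_Clim_ext_loc (fun n =>
      2 * z ^ 2 * (Csum (fun k => (-(1)) ^ k * T k) n
        - Csum (fun k => (-(1)) ^ k
                 * (residue_seq (2 * a) n k * weight a z k)) n)
      + (Gamma_seq (a + z) n * Gamma_seq (a - z) n
         - Gamma_seq a n * Gamma_seq a n))%C).
    + exists 0%nat. intros n _.
      rewrite Gamma_seq_product_minus_square by auto. ring.
    + replace (CGamma (a + z) * CGamma (a - z) - CGamma a * CGamma a)%C
        with (2 * z ^ 2 * 0
              + (CGamma (a + z) * CGamma (a - z) - CGamma a * CGamma a))%C by ring.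
      apply is_Clim_plus; [now apply is_Clim_scal|].
      apply is_Clim_minus; apply is_Clim_mult; now apply is_Clim_Gamma_seq.
  (* At [z = 0] the factor [z ^ 2] annihilates every partial sum, so no bound on [Re a] enters. *)
  - apply (is_Clim_ext_loc (fun _ => RtoC 0)).
    + exists 0%nat. intros n _. ring.
    + replace (CGamma (a + 0) * CGamma (a - 0) - CGamma a * CGamma a)%C
        with (RtoC 0); [apply is_Clim_const|].
      replace (a - 0)%C with a by ring. rewrite Cplus_0_r. ring.
Qed.
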